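(* A continuous graph $\Gamma\subset\mathbb{R}^3$ of finite total curvature is tame.
   Context: A continuous graph $\Gamma\subset\mathbb{R}^3$ is the image under a continuous embedding of a connected finite graph (finitely many vertices; edges are simple arcs whose endpoints are vertices). A graph in $\mathbb{R}^3$ is tame if it is (ambient) isotopic to a polyhedral graph, i.e. one whose edges are polygonal paths. A polygonal graph $P$ is $\Gamma$-approximating if it is inscribed in $\Gamma$, its vertices of degree $\ne2$ are exactly those of $\Gamma$ with the same degrees, and the arcs of $P$ between two such vertices correspond one-to-one to the edges of $\Gamma$ between those vertices (each edge of $\Gamma$ is replaced by a polygonal path through successive points of that edge; self-intersections of $P$ are disregarded). ''Total curvature'' may be understood in terms of any definition which includes the total curvature of the edges and is continuous as a function of the unit tangent vectors at each vertex. That is: for a polygonal graph $P$ it is the sum over vertices $q$ of contributions $c(T_1,\dots,T_{d})$ depending continuously on the unit vectors $T_1,\dots,T_d$ at $q$ pointing into the edges ending at $q$, and equal to the exterior angle $\arccos\langle T_1,-T_2\rangle$ when $d=2$; for a continuous graph $\Gamma$ it is the supremum over all $\Gamma$-approximating polygonal graphs. Examples include: - net total curvature NTC, with $c=\frac14\int_{S^2}[\sum_{i=1}^d\chi_i(e)]^+dA_{S^2}(e)$, $\chi_i=-1$ on the hemisphere centered at $T_i$ and $+1$ on the opposite hemisphere; - Taniyama's total curvature TC, with $c=\sum_{1\le i<j\le d}\arccos\langle T_i,-T_j\rangle$; - cone total curvature CTC, with $c=\sup_{e\in S^2}\sum_{i=1}^d(\frac\pi2-\arccos\langle T_i,e\rangle)$.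 *)

(* Defs.v *)
(* MathComp-Analysis.  R^3 is 'rV[R]_3 with its (product) topology, for an
   arbitrary R : realType. *)
From HB Require Import structures.
From mathcomp Require Import all_boot all_order all_algebra.
From mathcomp Require Import all_classical all_reals all_analysis.

Set Implicit Arguments.
Unset Strict Implicit.
Unset Printing Implicit Defensive.

Import Order.TTheory GRing.Theory Num.Theory.
Import numFieldNormedType.Exports.

Local Open Scope classical_set_scope.
Local Open Scope ring_scope.

(* The norm carried by 'rV[R]_3 in the library is the sup norm, hence the
   explicit Euclidean structure. *)
Definition dot (R : realType) (u v : 'rV[R]_3) : R := \sum_(i < 3) u 0 i * v 0 i.

Definition enorm (R : realType) (u : 'rV[R]_3) : R := Num.sqrt (dot u u).

Definition unit_dir (R : realType) (p q : 'rV[R]_3) : 'rV[R]_3 :=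
  (enorm (q - p))^-1 *: (q - p).

Definition segment (R : realType) (p q : 'rV[R]_3) : set 'rV[R]_3 :=
  [set (1 - t) *: p + t *: q | t in `[0, 1]].

(* Multiple edges and loops are allowed; the orientation of the edges is only
   used to parametrize them. *)
Record fin_graph := FinGraph {
  vertex : finType;
  edge : finType;
  src : edge -> vertex;
  tgt : edge -> vertex
}.

(* The half-edge (e, false) is the end of e at src e, and (e, true) the end of
   e at tgt e, so that a loop counts twice in the degree of its vertex. *)
Definition half_end (G : fin_graph) (h : edge G * bool) : vertex G :=
  if h.2 then tgt h.1 else src h.1.

Definition star (G : fin_graph) (v : vertex G) : {set edge G * bool} :=
  [set h | half_end h == v].

Definition adj (G : fin_graph) : rel (vertex G) :=
  fun v w => [exists e : edge G,
    ((src e == v) && (tgt e == w)) || ((src e == w) && (tgt e == v))].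

Definition connected_graph (G : fin_graph) : Prop :=
  (0 < #|vertex G|)%N /\ forall v w : vertex G, connect (@adj G) v w.

(* A continuous injective map to R^3 from the topological realization of G,
   i.e. from the quotient of vertex G + edge G * [0, 1] identifying (e, 0) with
   src e and (e, 1) with tgt e.  As the realization is compact, this is an
   embedding.  The values of edge_arc outside of [0, 1] are irrelevant. *)
Record continuous_graph (R : realType) (G : fin_graph) := ContinuousGraph {
  pos : vertex G -> 'rV[R]_3;
  edge_arc : edge G -> R -> 'rV[R]_3;
  arc_continuous : forall e, {within `[0, 1], continuous (edge_arc e)};
  arc_src : forall e, edge_arc e 0 = pos (src e);
  arc_tgt : forall e, edge_arc e 1 = pos (tgt e);
  pos_inj : injective pos;
  arc_neq_pos : forall e t v, t \in `]0, 1[ -> edge_arc e t <> pos v;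
  arc_inj : forall e e' t t', t \in `]0, 1[ -> t' \in `]0, 1[ ->
    edge_arc e t = edge_arc e' t' -> e = e' /\ t = t'
}.

(* s lists the interior points of a subdivision of [0, 1]. *)
Definition subdivision (R : realType) (s : seq R) : bool :=
  path <%R 0 (rcons s 1).

Definition polygonal_path (T : Type) (G : fin_graph)
    (p : vertex G -> T) (m : edge G -> seq T) (e : edge G) : seq T :=
  p (src e) :: rcons (m e) (p (tgt e)).

(* The polygonal graphs obtained from G by replacing every edge e by a
   polygonal path with interior vertices mid e.  Distinct vertices or edges may
   meet in R^3; only consecutive vertices are required to be distinct. *)
Record polygonal_graph (R : realType) (G : fin_graph) := PolygonalGraph {
  ppos : vertex G -> 'rV[R]_3;
  mid : edge G -> seq 'rV[R]_3;
  polygonal_path_neq : forall e,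
    sorted (fun x y => x != y) (polygonal_path ppos mid e)
}.

Definition approximating (R : realType) (G : fin_graph)
    (Gam : continuous_graph R G) (P : polygonal_graph R G) : Prop :=
  (forall v, ppos P v = pos Gam v) /\
  forall e, exists2 s : seq R, subdivision s &
    mid P e = [seq edge_arc Gam e t | t <- s].

(* The contribution c d T of a vertex of degree d, where the rows of T are the
   d unit vectors pointing into the edges at that vertex. *)
Definition contribution (R : realType) := forall d : nat, 'M[R]_(d, 3) -> R.

Definition unit_rows (R : realType) (d : nat) : set 'M[R]_(d, 3) :=
  [set T | forall i, enorm (row i T) = 1].

Definition exterior_angle (R : realType) (u v : 'rV[R]_3) : R :=
  acos (dot u (- v)).

Definition admissible (R : realType) (c : contribution R) : Prop :=
  (forall d, {within @unit_rows R d, continuous (c d)}) /\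
  (forall T : 'M[R]_(2, 3), unit_rows T ->
     c 2%N T = exterior_angle (row 0 T) (row 1 T)).

Definition half_tangent (R : realType) (G : fin_graph) (P : polygonal_graph R G)
    (h : edge G * bool) : 'rV[R]_3 :=
  let p := polygonal_path (ppos P) (mid P) h.1 in
  let q := if h.2 then rev p else p in
  unit_dir q`_0 q`_1.

(* The half-edges at v are listed in the order of their finType: c need not be
   symmetric, and the order is irrelevant when it is. *)
Definition vertex_curvature (R : realType) (c : contribution R) (G : fin_graph)
    (P : polygonal_graph R G) (v : vertex G) : R :=
  c #|star v| (\matrix_(i < #|star v|) half_tangent P (enum_val i)).

(* The sum over the vertices in the interior of the polygonal path replacing e,
   which have degree 2. *)
Definition edge_curvature (R : realType) (c : contribution R) (G : fin_graph)
    (P : polygonal_graph R G) (e : edge G) : R :=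
  let p := polygonal_path (ppos P) (mid P) e in
  \sum_(1 <= k < (size (mid P e)).+1)
     c 2%N (col_mx (unit_dir p`_k p`_k.-1) (unit_dir p`_k p`_k.+1)).

Definition polygonal_curvature (R : realType) (c : contribution R)
    (G : fin_graph) (P : polygonal_graph R G) : R :=
  \sum_(v : vertex G) vertex_curvature c P v +
  \sum_(e : edge G) edge_curvature c P e.

Definition total_curvature (R : realType) (c : contribution R) (G : fin_graph)
    (Gam : continuous_graph R G) : \bar R :=
  ereal_sup [set (polygonal_curvature c P)%:E | P in approximating Gam].

Definition polyhedral (R : realType) (G : fin_graph)
    (Gam : continuous_graph R G) : Prop :=
  forall e, exists2 s : seq R, subdivision s &
    let u := 0 :: rcons s 1 in
    forall k : nat, (k <= size s)%N ->
      edge_arc Gam e @` `[u`_k, u`_k.+1] =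
      segment (edge_arc Gam e u`_k) (edge_arc Gam e u`_k.+1).

Definition homeomorphism (T U : topologicalType) (f : T -> U) : Prop :=
  continuous f /\ exists g : U -> T, [/\ continuous g, cancel f g & cancel g f].

Definition ambient_isotopy (R : realType) (H : R -> 'rV[R]_3 -> 'rV[R]_3) : Prop :=
  [/\ {within `[0, 1] `*` [set: 'rV[R]_3],
         continuous (fun tx : R * 'rV[R]_3 => H tx.1 tx.2)},
      forall t, t \in `[0, 1] -> homeomorphism (H t)
    & forall x, H 0 x = x].

(* The isotopy carries the vertices and edges of Gam to those of Gam'. *)
Definition isotopic (R : realType) (G : fin_graph)
    (Gam Gam' : continuous_graph R G) : Prop :=
  exists2 H : R -> 'rV[R]_3 -> 'rV[R]_3, ambient_isotopy H &
    (forall v, H 1 (pos Gam v) = pos Gam' v) /\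
    (forall e, H 1 @` (edge_arc Gam e @` `[0, 1]) = edge_arc Gam' e @` `[0, 1]).

Definition tame (R : realType) (G : fin_graph) (Gam : continuous_graph R G) : Prop :=
  exists2 Gam' : continuous_graph R G, polyhedral Gam' & isotopic Gam Gam'.

(* Main.v *)
Require Import Defs.
From HB Require Import structures.
From mathcomp Require Import all_boot all_order all_algebra.
From mathcomp Require Import all_classical all_reals all_analysis.
From mathcomp Require Import ring lra.

Set Implicit Arguments.
Unset Strict Implicit.
Unset Printing Implicit Defensive.

Import Order.TTheory GRing.Theory Num.Theory.
Import numFieldNormedType.Exports.

Local Open Scope classical_set_scope.
Local Open Scope ring_scope.

(** A bound on the total curvature bounds the total turning of every polygon
    inscribed in an edge: the contributions of the vertices are bounded below,
    because unit vectors form a compact set, and the contributions of the inner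
    points of the edges are exterior angles, hence nonnegative
    ([turning_bound]).  So a point of an edge is not the limit, on either side,
    of infinitely many disjoint triples of points at which the edge turns by
    more than a fixed angle ([no_turn_right], [no_turn_left]): all the chords
    of a short enough one-sided neighbourhood have nearly the same direction
    ([straight_if_no_turn]).  By compactness of the interval, the edges are cut
    into finitely many nearly straight arcs ([directed_chain]).

    Nothing is known about the angles at the cut points.  In particular two
    arcs may leave a common endpoint in the same direction and twist
    infinitely often around each other, so the arcs are straightened in two
    steps ([straighten_network]).  Close to an endpoint, each arc meets each
    small sphere around that endpoint once, so that the arcs trace a motion of
    finitely many distinct points of a sphere, defined while the radius
    decreases to 0.  This motion is undone sphere by sphere by an infinite
    composition of homeomorphisms that preserve the distance to the endpoint
    ([untwist]); whatever they do on small spheres, the result is continuous at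
    the endpoint.  The arcs are then radial close to their endpoints and, away
    from the endpoints, distinct arcs are at a positive distance.  Replacing
    the arcs by fine inscribed polygons now moves the points of the network by
    a displacement which is a contraction: on a single arc because its chords
    have nearly the same direction, for points of distinct arcs because it is
    small compared with their distance.  A Lipschitz extension of this
    displacement to the whole space, subtracted from the identity, is a
    homeomorphism that makes all the arcs polygonal ([polygonalize]).

    The composite homeomorphism is at a bounded distance from the identity,
    and such a homeomorphism is the end of an ambient isotopy by the Alexander
    trick ([alexander_isotopy]).  The polyhedral graph is the image of the
    given one, with the same parametrization ([tame_of_polygonal_image]). *)

Ltac vring := by apply/matrixP => ? ?; rewrite ?mxE; ring.

(** * Continuity *)

Lemma continuous_at_epsP (R : realType) (U W : normedModType R) (f : U -> W) x :
  {for x, continuous f} <-> forall e, 0 < e ->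
    exists2 d, 0 < d & forall y, `|y - x| < d -> `|f y - f x| < e.
Proof.
split=> [cf e e0 | cf].
  have /cvgrPdist_lt /(_ _ e0) := cf.
  move=> /nbhs_normP [d /= d0 Hd]; exists d => // y yx.
  by rewrite distrC; apply: Hd => /=; rewrite distrC.
apply/cvgrPdist_lt => e e0; have [d d0 Hd] := cf e e0.
apply/nbhs_normP; exists d => //= y; rewrite /= => yx.
by rewrite distrC; apply: Hd; rewrite distrC.
Qed.

Lemma continuous_epsP (R : realType) (U W : normedModType R) (f : U -> W) :
  continuous f <-> forall x e, 0 < e ->
    exists2 d, 0 < d & forall y, `|y - x| < d -> `|f y - f x| < e.
Proof. by split=> cf x; apply/continuous_at_epsP; exact: cf. Qed.

Lemma continuous_lipschitz (R : realType) (U W : normedModType R) (f : U -> W) (k : R) :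
  (forall x y, `|f x - f y| <= k * `|x - y|) -> continuous f.
Proof.
move=> fk; apply/continuous_epsP => x e e0.
have k0 : 0 < `|k| + 1 by rewrite ltr_wpDl.
exists (e / (`|k| + 1)); first by rewrite divr_gt0.
move=> y; rewrite ltr_pdivlMr // => yx; apply: le_lt_trans (fk y x) _.
apply: le_lt_trans yx; rewrite mulrC ler_wpM2l //.
by have := ler_norm k; lra.
Qed.

Lemma max_lip (R : realType) (m a b : R) :
  `|Num.max m a - Num.max m b| <= `|a - b|.
Proof.
rewrite !maxEle; case: (leP m a) => ha; case: (leP m b) => hb; rewrite ?subrr ?normr0 //.
  by rewrite !ger0_norm; lra.
by rewrite distrC (distrC a) !ger0_norm; lra.
Qed.

Lemma min_lip (R : realType) (m a b : R) :
  `|Num.min m a - Num.min m b| <= `|a - b|.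
Proof.
have E x : Num.min m x = - Num.max (- m) (- x) by rewrite oppr_max !opprK.
by rewrite !E opprK addrC; apply: le_trans (max_lip _ _ _) _; rewrite opprK addrC.
Qed.

Section ContinuityRules.
Variables (R : realType) (T : topologicalType) (W : normedModType R).
Implicit Types (f g : T -> W) (s : T -> R).

Lemma continuous_add f g : continuous f -> continuous g ->
  continuous (fun x => f x + g x).
Proof. by move=> cf cg x; apply: cvgD; [exact: cf|exact: cg]. Qed.

Lemma continuous_sub f g : continuous f -> continuous g ->
  continuous (fun x => f x - g x).
Proof. by move=> cf cg x; apply: cvgB; [exact: cf|exact: cg]. Qed.

Lemma continuous_scale s f : continuous s -> continuous f ->
  continuous (fun x => s x *: f x).
Proof. by move=> cf cg x; apply: cvgZ; [exact: cf|exact: cg]. Qed.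

Lemma continuous_norm f : continuous f -> continuous (fun x => `|f x|).
Proof. by move=> cf x; apply: cvg_norm; exact: cf. Qed.

Lemma continuous_sum (I : finType) (P : pred I) (F : I -> T -> W) :
  (forall i, P i -> continuous (F i)) ->
  continuous (fun x => \sum_(i | P i) F i x).
Proof.
move=> cF x; apply: cvg_big => [|i Pi]; last exact: cF.
exact: add_continuous.
Qed.
End ContinuityRules.

Lemma compact_pos_bound (R : realType) (T : topologicalType) (f : T -> R) (A : set T) :
  compact A -> continuous f -> (forall x, A x -> 0 < f x) ->
  exists2 m, 0 < m & forall x, A x -> m <= f x.
Proof.
move=> cA cf f0; have [A0|/nonemptyPn ->] := pselect (A !=set0); last by exists 1.
have [|c cA' fc] := compact_EVT_min A0 cA (f := f).
  exact: continuous_subspaceT.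
exists (f c); first by apply: f0; rewrite inE in cA'.
by move=> x Ax; apply: fc; rewrite inE.
Qed.

Lemma dist_continuous (R : realType) (U : normedModType R) (f : U -> U) y0 :
  continuous f -> continuous (fun x => `|f x - y0|).
Proof.
move=> cf x; apply: (@continuous_comp _ _ _ (fun x => f x - y0) (fun z => `|z|)).
  by apply: cvgB; [exact: cf|exact: cvg_cst].
exact: norm_continuous.
Qed.

Lemma compact_shell (R : realType) (x0 y0 : 'rV[R]_3) (e C : R) :
  compact [set x | e <= `|x - x0| /\ `|x - y0| <= C].
Proof.
apply: bounded_closed_compact.
  exists (C + `|y0|); split; first exact: num_real.
  move=> M CM x /= [_ xC]; rewrite -(subrK y0 x).
  by apply: le_trans (ler_normD _ _) _; lra.
have -> : [set x | e <= `|x - x0| /\ `|x - y0| <= C] =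
   ((fun x : 'rV[R]_3 => `|x - x0|) @^-1` [set z | e <= z]) `&`
   ((fun x : 'rV[R]_3 => `|x - y0|) @^-1` [set z | z <= C]) by [].
apply: closedI; (apply: closed_comp; [move=> x _ | by [exact: closed_ge|exact: closed_le]]).
  by apply: dist_continuous => ?; exact: cvg_id.
by apply: dist_continuous => ?; exact: cvg_id.
Qed.

(** * Homeomorphisms close to the identity and isotopies *)

(** A bounded displacement makes [f] proper: the points mapped close to [y0] stay
    in a compact set, on which [f] stays away from [y0] unless one is close to
    [g y0]. *)
Lemma bij_inv_continuous (R : realType) (f g : 'rV[R]_3 -> 'rV[R]_3) (C : R) :
  continuous f -> cancel f g -> cancel g f -> (forall x, `|f x - x| <= C) ->
  continuous g.
Proof.
move=> cf fK gK fC; apply/continuous_epsP => y0 e e0.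
have [m m0 Hm] := @compact_pos_bound R _ (fun x => `|f x - y0|) _
  (@compact_shell R (g y0) y0 e (C + 1)) (dist_continuous cf) (ltac:(
   move=> x /= [ex _]; rewrite normr_gt0 subr_eq0; apply/eqP => fxy;
   move: ex; rewrite -fxy fK subrr normr0 leNgt e0 //)).
exists (Num.min m 1); first by rewrite lt_min m0 ltr01.
move=> y; rewrite lt_min => /andP[ym y1]; rewrite ltNge; apply/negP => ge.
suff : m <= `|f (g y) - y0| by rewrite gK leNgt ym.
apply: Hm; split=> //; have := fC (g y); rewrite gK => h.
have -> : g y - y0 = (y - y0) - (y - g y) by vring.
by apply: le_trans (ler_normB _ _) _; lra.
Qed.

Lemma continuous_prodP (R : realType) (f : R * 'rV[R]_3 -> 'rV[R]_3) t x :
  (forall e, 0 < e -> exists2 d, 0 < d & forall s y, `|s - t| < d -> `|y - x| < d ->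
     `|f (s, y) - f (t, x)| < e) -> {for (t, x), continuous f}.
Proof.
move=> H; apply/cvgrPdist_lt => e e0; have [d d0 Hd] := H e e0.
exists (ball t d, ball x d) => /=; first by split; apply: nbhsx_ballx.
move=> [s y] [/= sB yB]; rewrite distrC; apply: Hd.
  by move: sB; rewrite -ball_normE /= distrC.
by move: yB; rewrite -ball_normE /= distrC.
Qed.

(** The Alexander trick: conjugating [f] by the dilations of ratio [t] divides its
    displacement accordingly, so that [f] shrinks to the identity as [t] tends
    to 0. *)
Lemma alexander_isotopy (R : realType) (f g : 'rV[R]_3 -> 'rV[R]_3) (C : R) :
  continuous f -> cancel f g -> cancel g f -> (forall x, `|f x - x| <= C) ->
  exists2 H : R -> 'rV[R]_3 -> 'rV[R]_3, ambient_isotopy H & H 1 = f.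
Proof.
move=> cf fK gK fC.
have cg := bij_inv_continuous cf fK gK fC.
(* For t = 0 this is the identity, because 0^-1 = 0. *)
pose H (t : R) (x : 'rV[R]_3) := x + t *: (f (t^-1 *: x) - t^-1 *: x).
have HE t x : t != 0 -> H t x = t *: f (t^-1 *: x).
  by move=> t0; rewrite /H scalerBr scalerA divff // scale1r addrC subrK.
have C0 : 0 <= C by apply: le_trans (fC 0).
exists H; last first.
  by apply/funext => x; rewrite HE ?oner_eq0 // invr1 !scale1r.
split.
- apply: continuous_subspaceT => -[t x].
  have [->|t0] := eqVneq t 0.
    apply: continuous_prodP => e e0.
    have C2 : 0 < C + 2 by lra.
    pose d := e / (C + 2); have d0 : 0 < d by rewrite divr_gt0.
    have ed : e = d * C + 2 * d by rewrite -[LHS](divfK (lt0r_neq0 C2)) -/d; ring.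
    exists d => // s y; rewrite subr0 /= => hs hy; rewrite {2}/H scale0r addr0.
    have -> : H s y - x = (y - x) + s *: (f (s^-1 *: y) - s^-1 *: y).
      by rewrite /H addrAC.
    apply: le_lt_trans (ler_normD _ _) _; rewrite normrZ.
    have h1 : `|s| * `|f (s^-1 *: y) - s^-1 *: y| <= d * C.
      by apply: ler_pM => //; exact: ltW.
    by lra.
  have cH : {for (t, x), continuous (fun tx : R * 'rV[R]_3 => tx.1 *: f (tx.1^-1 *: tx.2))}.
    apply: cvgZ; first exact: cvg_fst.
    apply: (@continuous_comp _ _ _ (fun tx : R * 'rV[R]_3 => tx.1^-1 *: tx.2) f); last exact: cf.
    have cV := @cvgV R _ (nbhs (t, x)) _ (fun tx : R * 'rV[R]_3 => tx.1) t t0 cvg_fst.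
    apply: cvgZ; [exact: cV|exact: cvg_snd].
  have : \forall tx \near (t, x), tx.1 *: f (tx.1^-1 *: tx.2) = H tx.1 tx.2.
    exists (ball t `|t|, setT) => /=.
      by split; [apply: nbhsx_ballx; rewrite normr_gt0|exact: filterT].
    move=> [s y] [/= sB _]; rewrite HE //; move: sB; rewrite -ball_normE /=.
    by apply: contraTneq => ->; rewrite subr0 ltxx.
  move=> nE; have E0 : H t x = t *: f (t^-1 *: x) by rewrite HE.
  move=> A; rewrite /= E0 => nA; have := cH A nA.
  move=> h; change (nbhs (t, x) ((fun tx : R * 'rV[R]_3 => H tx.1 tx.2) @^-1` A)).
  change (nbhs (t, x) ((fun tx : R * 'rV[R]_3 => tx.1 *: f (tx.1^-1 *: tx.2)) @^-1` A)) in h.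
  by apply: filterS2 nE h => z /= <-.
- move=> t _; have [->|t0] := eqVneq t 0.
    have E : H 0 = id by apply/funext => x; rewrite /H scale0r addr0.
    by rewrite E; split; [|exists id; split] => // x; exact: cvg_id.
  have -> : H t = fun x => t *: f (t^-1 *: x) by apply/funext => x; rewrite HE.
  have cs (k : R) : continuous (fun x : 'rV[R]_3 => k *: x).
    by apply: (@continuous_lipschitz _ _ _ _ `|k|) => x y; rewrite -scalerBr normrZ.
  have cc (k l : R) (h : 'rV[R]_3 -> 'rV[R]_3) : continuous h ->
    continuous (fun x : 'rV[R]_3 => k *: h (l *: x)).
    move=> ch x; apply: (@continuous_comp _ _ _ (fun x : 'rV[R]_3 => h (l *: x)) ( *:%R k)); last exact: cs.
    by apply: (@continuous_comp _ _ _ (fun x : 'rV[R]_3 => l *: x) h); [exact: cs|exact: ch].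
  split; first exact: cc.
  exists (fun y => t *: g (t^-1 *: y)); split; first exact: cc.
    by move=> x; rewrite scalerA mulVf // scale1r fK scalerA divff // scale1r.
  by move=> x; rewrite scalerA mulVf // scale1r gK scalerA divff // scale1r.
- by move=> x; rewrite /H scale0r addr0.
Qed.

(** Surjectivity: let [c] minimize the distance from [x + f x] to [y].  One step
    of the fixed point iteration from [c] at least halves this distance, which is
    therefore 0. *)
Lemma id_add_contraction_bij (R : realType) (f : 'rV[R]_3 -> 'rV[R]_3) :
  (forall x y, `|f x - f y| <= 2^-1 * `|x - y|) ->
  injective (fun x => x + f x) /\ forall y, exists x, x + f x = y.
Proof.
move=> fL; split=> [x y /= xy|y].
  have := fL x y; have -> : f x - f y = - (x - y).
    have -> : f x = y + f y - x by rewrite -xy; vring.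
    vring.
  rewrite normrN => h; apply/eqP; rewrite -subr_eq0 -normr_eq0.
  by apply/eqP; have := normr_ge0 (x - y); move: h; lra.
pose M := 4 * `|f 0 - y|.
have cf : continuous (fun x : 'rV[R]_3 => `|x + f x - y|).
  apply: dist_continuous; apply: (@continuous_lipschitz _ _ _ _ 2) => u v.
  have -> : u + f u - (v + f v) = (u - v) + (f u - f v) by vring.
  apply: le_trans (ler_normD _ _) _.
  by have := fL u v; have := normr_ge0 (u - v); lra.
have lb x : `|x| <= 2 * `|x + f x - y| + 2 * `|f 0 - y|.
  have := fL x 0; rewrite subr0 => h.
  have := ler_normB ((x + f x - y) - (f x - f 0)) (f 0 - y).
  have := ler_normB (x + f x - y) (f x - f 0).
  have : `|x| = `|(x + f x - y) - (f x - f 0) - (f 0 - y)| by congr `|_|; vring.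
  lra.
have [||c _ Hc] := @compact_EVT_min _ R (fun x : 'rV[R]_3 => `|x + f x - y|) _ _
    (@compact_shell R 0 0 0 M).
- by exists 0; split; rewrite ?subr0 //= normr0 /M mulr_ge0.
- exact: continuous_subspaceT.
exists c; apply/eqP; rewrite -subr_eq0 -normr_eq0.
pose d := c - (c + f c - y).
have hd : `|d + f d - y| <= 2^-1 * `|c + f c - y|.
  have -> : d + f d - y = f d - f c by rewrite /d; vring.
  by apply: le_trans (fL _ _) _; rewrite /d addrAC subrr add0r normrN.
have inM z : `|z + f z - y| <= `|0 + f 0 - y| ->
    z \in [set x : 'rV[R]_3 | 0 <= `|x - 0| /\ `|x - 0| <= M].
  rewrite add0r => h; rewrite inE; split; rewrite // subr0.
  by apply: le_trans (lb z) _; rewrite /M; lra.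
have h0 := Hc 0 (inM 0 (lexx _)).
have := Hc d; rewrite inM; last first.
  by apply: le_trans hd _; have := normr_ge0 (c + f c - y); lra.
move=> /(_ isT) h; apply/eqP.
by have := normr_ge0 (c + f c - y); lra.
Qed.

(** * Lipschitz extension *)

(** McShane's formula, the infimum of [D z + k * `|x - q z|] over [z], truncated at
    [B] so as to remain bounded.  The index type [Z] stands for a subset of [U]:
    the Lipschitz condition makes [D z] depend on [q z] only. *)
Lemma lipschitz_extension (R : realType) (U : normedModType R) (Z : Type) (z0 : Z)
    (q : Z -> U) (D : Z -> R) (k B : R) : 0 <= k ->
  (forall z, `|D z| <= B) -> (forall z z', `|D z - D z'| <= k * `|q z - q z'|) ->
  exists g : U -> R, [/\ forall x y, `|g x - g y| <= k * `|x - y|,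
    forall x, `|g x| <= B & forall z, g (q z) = D z].
Proof.
move=> k0 DB DL.
pose h x z := Num.min B (D z + k * `|x - q z|).
pose g x := inf [set h x z | z in setT].
have lbh x : lbound [set h x z | z in setT] (- B).
  move=> _ [z _ <-]; rewrite /h le_min; have := DB z; rewrite ler_norml => /andP[h1 h2].
  have := mulr_ge0 k0 (normr_ge0 (x - q z)).
  by move=> h3; apply/andP; split; lra.
have gle x z : g x <= h x z.
  by apply: ge_inf; [exists (- B); exact: lbh|exists z].
have leg x m : (forall z, m <= h x z) -> m <= g x.
  move=> H; apply: lb_le_inf; first by exists (h x z0), z0.
  by move=> _ [z _ <-].
have one x y : g x <= g y + k * `|x - y|.
  rewrite -lerBlDr; apply: leg => z; rewrite lerBlDr.
  apply: le_trans (gle x z) _; rewrite /h.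
  have hz : k * `|x - q z| <= k * `|y - q z| + k * `|x - y|.
    rewrite -mulrDr ler_wpM2l //.
    by have := ler_distD y x (q z); lra.
  have kp := mulr_ge0 k0 (normr_ge0 (x - y)).
  by rewrite addr_minl le_min !ge_min; apply/andP; split; apply/orP; [left|right]; lra.
exists g; split.
- move=> x y; rewrite ler_norml; apply/andP; split; last by rewrite lerBlDl one.
  by have := one y x; rewrite distrC; lra.
- move=> x; rewrite ler_norml; apply/andP; split; first by apply: leg => z; apply: lbh; exists z.
  by apply: le_trans (gle x z0) _; rewrite /h ge_min lexx.
- move=> z; apply/eqP; rewrite eq_le; apply/andP; split.
    by apply: le_trans (gle _ z) _; rewrite /h subrr normr0 mulr0 addr0 ge_min lexx orbT.
  apply: leg => z'; rewrite /h le_min; apply/andP; split.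
    by apply: le_trans (ler_norm _) (DB z).
  by have := DL z z'; have := ler_norm (D z - D z'); lra.
Qed.

Lemma normr_rowP (R : realType) n (x : 'rV[R]_n) (c : R) : 0 <= c ->
  (`|x| <= c) <-> forall i, `|x 0 i| <= c.
Proof.
move=> c0; split => [h i|h].
  by apply: le_trans h; rewrite [leRHS]mx_normrE; apply: (le_bigmax _ (fun ij => `|x ij.1 ij.2|) (0, i)).
rewrite [leLHS]mx_normrE; apply: bigmax_le => // -[i j] _ /=.
by rewrite (ord1 i).
Qed.

(** The constant [k] survives because the norm is the sup norm: the extension is
    made coordinate by coordinate. *)
Lemma lipschitz_extension_rV (R : realType) (Z : Type) (q D : Z -> 'rV[R]_3) (k B : R) :
  0 <= k -> 0 <= B ->
  (forall z, `|D z| <= B) -> (forall z z', `|D z - D z'| <= k * `|q z - q z'|) ->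
  exists g : 'rV[R]_3 -> 'rV[R]_3, [/\ forall x y, `|g x - g y| <= k * `|x - y|,
    forall x, `|g x| <= B & forall z, g (q z) = D z].
Proof.
move=> k0 B0 DB DL.
have [[z0]|nZ] := pselect (inhabited Z); last first.
  exists (fun=> 0); split => [x y|x|z]; last by case: nZ.
    by rewrite subrr normr0 mulr_ge0.
  by rewrite normr0.
have comp (i : 'I_3) := @lipschitz_extension R _ Z z0 q (fun z => D z 0 i) k B k0
  (fun z => (normr_rowP _ B0).1 (DB z) i) (ltac:(
    move=> z z'; have := (normr_rowP _ (mulr_ge0 k0 (normr_ge0 (q z - q z')))).1 (DL z z') i;
    by rewrite !mxE)).
have [g Hg] := choice comp.
exists (fun x => \row_i g i x); split.
- move=> x y; apply/normr_rowP; first by rewrite mulr_ge0.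
  by move=> i; rewrite !mxE; have [h _ _] := Hg i; exact: h.
- by move=> x; apply/normr_rowP => // i; rewrite mxE; have [_ h _] := Hg i; exact: h.
- by move=> z; apply/rowP => i; rewrite mxE; have [_ _ h] := Hg i; exact: h.
Qed.

(** * Untwisting a moving configuration of points of a sphere *)

Lemma finite_uniform_pos (R : realType) (I : finType) (P : I -> R -> Prop) :
  (forall i m m', 0 < m' -> m' <= m -> P i m -> P i m') ->
  (forall i, exists2 m, 0 < m & P i m) -> exists2 m, 0 < m & forall i, P i m.
Proof.
move=> Pm Pe; have [m Hm] := choice (fun i => let: ex_intro2 x h1 h2 := Pe i in
  ex_intro (fun m => 0 < m /\ P i m) x (conj h1 h2)).
pose M := \big[Num.min/1]_i m i.
have M0 : 0 < M by rewrite /M; apply: lt_bigmin => // i _; have [] := Hm i.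
exists M => // i; have [h1 h2] := Hm i; apply: (Pm i (m i)) => //.
exact: bigmin_le_cond.
Qed.

(** Each step is chosen at least half as long as every other good step from the
    same point.  If the sequence had a positive limit, a good step across this
    limit would eventually be available, and half of it would already pass the
    limit. *)
Lemma greedy_sequence (R : realType) (good : R -> R -> Prop) (r0 : R) : 0 < r0 ->
  (forall r, 0 < r <= r0 -> exists2 d, 0 < d & forall a b, r - d < a -> a < b ->
     b < r + d -> 0 < a -> b <= r0 -> good a b) ->
  exists s : nat -> R, [/\ s 0%N = r0, forall n, 0 < s n, forall n, s n.+1 < s n,
    forall n, good (s n.+1) (s n) & forall x, 0 < x -> exists n, s n <= x].
Proof.
move=> r00 loc.
pose ok b a := 0 < a /\ a < b /\ good a b.
have step b : exists a, 0 < b <= r0 -> ok b a /\ forall a', ok b a' -> a <= (b + a') / 2.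
  have [hb|] := pselect (0 < b <= r0); last by move=> nb; exists 0.
  pose S := [set a | ok b a].
  have [d d0 Hd] := loc b hb.
  have S0 : S !=set0.
    exists (Num.max (b / 2) (b - d / 2)); case/andP: hb => b0 br; split.
      by rewrite lt_max; apply/orP; left; lra.
    split; first by rewrite gt_max; apply/andP; split; lra.
    apply: Hd => //.
    - by rewrite lt_max; apply/orP; right; lra.
    - by rewrite gt_max; apply/andP; split; lra.
    - lra.
    - by rewrite lt_max; apply/orP; left; lra.
  have Slb : has_lbound S by exists 0 => a [/ltW].
  have iS : inf S < b.
    have [a Sa] := S0; have [_ [ab _]] := Sa; exact: le_lt_trans (ge_inf Slb Sa) ab.
  have [a Sa ai] := @inf_adherent R S ((b - inf S) / 2) (ltac:(lra)) (conj S0 Slb).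
  exists a => _; split => // a' Sa'; apply: ltW; apply: lt_le_trans ai _.
  have : inf S <= a' by exact: (ge_inf Slb Sa').
  lra.
have [next Hn] := choice step.
pose s n := iter n next r0.
have sP n : 0 < s n <= r0.
  elim: n => [|n IH]; first by rewrite /s /= r00 lexx.
  have [[h1 [h2 _]] _] := Hn _ IH; rewrite /s /= -/(s n) h1 /=.
  by apply: (le_trans (ltW h2)); case/andP: IH.
have sd n : s n.+1 < s n by have [[_ []]] := Hn _ (sP n).
exists s; split => //.
- by move=> n; case/andP: (sP n).
- by move=> n; have [[_ [_]]] := Hn _ (sP n).
move=> x x0; apply: contrapT => H.
have H' n : x < s n by rewrite ltNge; apply/negP => h; apply: H; exists n.
pose l := inf (range s).
have S0 : range s !=set0 by exists (s 0%N), 0%N.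
have Slb : has_lbound (range s) by exists x => _ [n _ <-]; exact: ltW.
have xl : x <= l by apply: lb_le_inf => // _ [n _ <-]; exact: ltW.
have ls n : l <= s n by apply: ge_inf => //; exists n.
have [|d d0 Hd] := loc l.
  by apply/andP; split; [exact: lt_le_trans xl|exact: ls 0%N].
(* [x] is positive and at most [l], so that steps of size at most [d'] from
   points close to [l] end at positive radii. *)
pose d' := Num.min d x.
have d'0 : 0 < d' by rewrite lt_min d0.
have dd : d' <= d by rewrite ge_min lexx.
have dx : d' <= x by rewrite ge_min lexx orbT.
have [_ [n _ <-] sn] := @inf_adherent R (range s) (d' / 4) (ltac:(lra)) (conj S0 Slb).
have [_ Hs] := Hn _ (sP n).
have lsn := ls n; have ls1 := ls n.+1; have /andP[s0 sr] := sP n.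
rewrite -/l in sn.
clearbody d' l.
have okl : ok (s n) (l - d' / 2).
  by split; [lra|split; [lra|apply: Hd => //; lra]].
have E : next (s n) = s n.+1 by [].
by have := Hs _ okl; rewrite E; lra.
Qed.

Fixpoint comp_upto (T : Type) (h : nat -> T -> T) n : T -> T :=
  if n is m.+1 then comp_upto h m \o h m else id.

(** On the complement of a ball around 0 only finitely many of the [h n] differ
    from the identity; at 0, continuity holds because norms are preserved. *)
Lemma infinite_composition (R : realType) (h : nat -> 'rV[R]_3 -> 'rV[R]_3)
    (s : nat -> R) :
  (forall n, 0 < s n) -> (forall n, s n.+1 < s n) ->
  (forall x, 0 < x -> exists n, s n <= x) ->
  (forall n, continuous (h n)) -> (forall n, injective (h n)) ->
  (forall n y, exists x, h n x = y) -> (forall n x, `|h n x| = `|x|) ->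
  (forall n x, s n <= `|x| -> h n x = x) ->
  exists Psi : 'rV[R]_3 -> 'rV[R]_3, [/\ continuous Psi, injective Psi,
    forall y, exists x, Psi x = y, forall x, `|Psi x| = `|x| &
    forall n x, s n <= `|x| -> Psi x = comp_upto h n x].
Proof.
move=> s0 sd sx hc hi hs hn hf.
have hom m n : (n <= m)%N -> s m <= s n.
  elim: m => [|m IH]; first by rewrite leqn0 => /eqP ->.
  rewrite leq_eqVlt => /orP[/eqP -> //|nm].
  by apply: le_trans (ltW (sd m)) _; exact: IH.
have cn n x : `|comp_upto h n x| = `|x|.
  by elim: n x => //= n IH x; rewrite IH hn.
have cstab m n x : (n <= m)%N -> s n <= `|x| -> comp_upto h m x = comp_upto h n x.
  elim: m x => [|m IH] x; first by rewrite leqn0 => /eqP ->.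
  rewrite leq_eqVlt => /orP[/eqP -> //|nm] sx'.
  by rewrite /= hf ?IH //; apply: le_trans sx'; exact: hom.
have cinj n : injective (comp_upto h n).
  by elim: n => [|n IH] x y //= /IH /hi.
have csurj n y : exists x, comp_upto h n x = y.
  elim: n y => [|n IH] y; first by exists y.
  have [z <-] := IH y; have [x <-] := hs n z; by exists x.
have ccont n : continuous (comp_upto h n).
  elim: n => [|n IH] x /=; first exact: cvg_id.
  by apply: continuous_comp; [exact: hc|exact: IH].
have ex1 x : exists n, x != 0 -> s n <= `|x :> 'rV[R]_3|.
  have [->|x0] := eqVneq x 0; first by exists 0%N; rewrite ?eqxx.
  by have [n Hn] := sx `|x| (ltac:(by rewrite normr_gt0)); exists n.
have [N HN] := choice ex1.
pose Psi (x : 'rV[R]_3) := if x == 0 then 0 else comp_upto h (N x) x.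
have PsiE n (x : 'rV[R]_3) : s n <= `|x| -> Psi x = comp_upto h n x.
  move=> snx; have x0 : x != 0 by rewrite -normr_gt0; exact: lt_le_trans snx.
  rewrite /Psi (negbTE x0); case/orP: (leq_total n (N x)) => nN; first exact: cstab.
  by symmetry; apply: cstab => //; exact: HN.
have Psi0 : Psi 0 = 0 by rewrite /Psi eqxx.
have Psin x : `|Psi x| = `|x|.
  by rewrite /Psi; case: eqVneq => [->|_]; rewrite ?cn.
have ex (x : 'rV[R]_3) : x != 0 -> exists n, s n <= `|x| by move=> x0; exists (N x); exact: HN.
exists Psi; split => //.
- apply/continuous_epsP => x e e0.
  have [->|x0] := eqVneq x 0.
    by exists e => // y; rewrite Psi0 !subr0 Psin.
  have xh : 0 < `|x| / 2 by rewrite divr_gt0 ?normr_gt0.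
  have [n Hn] := sx _ xh.
  have [d d0 Hd] := (continuous_epsP (comp_upto h n)).1 (ccont n) x e e0.
  exists (Num.min d (`|x| / 2)); first by rewrite lt_min d0.
  move=> y; rewrite lt_min => /andP[yd yx].
  rewrite !(PsiE n); first exact: Hd.
    by apply: le_trans Hn _; move: xh; lra.
  apply: le_trans Hn _; rewrite distrC in yx.
  by have := lerB_dist x y; lra.
- move=> x y; have [->|x0] := eqVneq x 0.
    rewrite Psi0 => /(congr1 (fun z => `|z|)); rewrite normr0 Psin => /esym/eqP.
    by rewrite normr_eq0 => /eqP ->.
  have [n Hn] := ex x x0.
  move=> E; have nE : `|x| = `|y| by rewrite -(Psin x) E Psin.
  by move: E; rewrite !(PsiE n) -?nE // => /cinj.
- move=> y; have [->|y0] := eqVneq y 0; first by exists 0.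
  have [n Hn] := ex y y0; have [x xy] := csurj n y.
  by exists x; rewrite (PsiE n) // -(cn n) xy.
Qed.

(** A function which is positively homogeneous of degree 1, equal to 1 at the unit
    vector [c] and supported by a cone around the half-line of [c], whose
    aperture is controlled by [M]. *)
Definition bump (R : realType) (M : R) (c x : 'rV[R]_3) : R :=
  Num.max 0 (`|x| - M * `|x - `|x| *: c|).

(** A perturbation of the identity that moves the unit vectors [c j] to [d j], when
    they are far apart and [d j] is close to [c j]; being homogeneous, it also acts on each sphere around 0 once it is
    normalized. *)
Definition level_map (R : realType) (J : finType) (Q : pred J) (M : R)
    (d c : J -> 'rV[R]_3) (x : 'rV[R]_3) : 'rV[R]_3 :=
  x + \sum_(j | Q j) bump M (c j) x *: (d j - c j).

Lemma bump_lip (R : realType) (M : R) (c x y : 'rV[R]_3) : 0 <= M -> `|c| <= 1 ->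
  `|bump M c x - bump M c y| <= (1 + 2 * M) * `|x - y|.
Proof.
move=> M0 c1; rewrite /bump; apply: le_trans (max_lip _ _ _) _.
have -> : `|x| - M * `|x - `|x| *: c| - (`|y| - M * `|y - `|y| *: c|) =
  (`|x| - `|y|) - M * (`|x - `|x| *: c| - `|y - `|y| *: c|) by ring.
have h1 := ler_dist_dist x y.
have h2 := ler_dist_dist (x - `|x| *: c) (y - `|y| *: c).
apply: le_trans (ler_normB _ _) _; rewrite normrM (ger0_norm M0).
suff : `|(`|x - `|x| *: c| - `|y - `|y| *: c|)| <= 2 * `|x - y|.
  by move=> h; have := ler_wpM2l M0 h; lra.
apply: le_trans h2 _.
have -> : x - `|x| *: c - (y - `|y| *: c) = (x - y) - (`|x| - `|y|) *: c by vring.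
apply: le_trans (ler_normB _ _) _; rewrite normrZ.
by have := ler_wpM2l (normr_ge0 (`|x| - `|y|)) c1; lra.
Qed.

Section LevelMap.
Variables (R : realType) (J : finType) (Q : pred J) (M : R) (d c : J -> 'rV[R]_3).
Hypothesis M0 : 0 <= M.
Hypothesis c1 : forall j, Q j -> `|c j| = 1.
Hypothesis csep : forall i j, Q i -> Q j -> i != j -> 1 <= M * `|c i - c j|.
Hypothesis small : \sum_(j | Q j) `|d j - c j| * (1 + 2 * M) <= 2^-1.
Local Notation G := (level_map Q M d c).

Lemma level_map_pert x y :
  `|\sum_(j | Q j) bump M (c j) x *: (d j - c j) -
    \sum_(j | Q j) bump M (c j) y *: (d j - c j)| <= 2^-1 * `|x - y|.
Proof.
rewrite -sumrB.
apply: le_trans (ler_norm_sum _ _ _) _.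
apply: le_trans (_ : \sum_(j | Q j) (`|d j - c j| * (1 + 2 * M)) * `|x - y| <= _).
  apply: ler_sum => j Qj; rewrite -scalerBl normrZ [leLHS]mulrC -mulrA.
  by rewrite ler_wpM2l // bump_lip // c1.
by rewrite -mulr_suml ler_wpM2r.
Qed.

Lemma level_map_inj : injective G.
Proof. by have [] := id_add_contraction_bij level_map_pert. Qed.

Lemma level_map_surj y : exists x, G x = y.
Proof. by have [_] := id_add_contraction_bij level_map_pert; exact. Qed.

Lemma bumpZ (l : R) (e x : 'rV[R]_3) : 0 <= l -> bump M e (l *: x) = l * bump M e x.
Proof.
move=> l0; rewrite /bump maxr_pMr // mulr0 normrZ (ger0_norm l0).
rewrite -scalerA -scalerBr normrZ (ger0_norm l0); congr Num.max; ring.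
Qed.

Lemma level_mapZ (l : R) (x : 'rV[R]_3) : 0 <= l -> G (l *: x) = l *: G x.
Proof.
move=> l0; rewrite /level_map scalerDr; congr (_ + _); rewrite scaler_sumr.
by apply: eq_bigr => j _; rewrite bumpZ // scalerA.
Qed.

Lemma level_map0 : G 0 = 0.
Proof. by rewrite -(scale0r (0 : 'rV[R]_3)) level_mapZ // !scale0r. Qed.

Lemma level_map_eq0 x : (G x == 0) = (x == 0).
Proof.
apply/eqP/eqP => [|->]; last exact: level_map0.
by move=> E; apply: level_map_inj; rewrite E level_map0.
Qed.

Lemma level_map_on j : Q j -> G (c j) = d j.
Proof.
move=> Qj; rewrite /level_map (bigD1 j) //= big1 ?addr0.
  rewrite /bump (c1 Qj) scale1r subrr normr0 mulr0 subr0 maxEle ler01 scale1r.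
  by vring.
move=> i /andP[Qi ij]; rewrite /bump (c1 Qj) scale1r.
have h := csep Qj Qi (ltac:(by rewrite eq_sym)).
rewrite (_ : Num.max _ _ = 0) ?scale0r //.
by apply/max_idPl; rewrite subr_le0.
Qed.
End LevelMap.

(** Between the radii [a] and [b] the configuration moves so little, compared with
    the distances of its points, that [level_map] brings it to its position at
    [b] by adding a contraction to the identity. *)
Definition slow_shell (R : realType) (J : finType) (Q : pred J)
    (c : J -> R -> 'rV[R]_3) (a b : R) :=
  exists2 M, 0 <= M & forall r, a <= r <= b ->
   (forall i j, Q i -> Q j -> i != j -> 1 <= M * `|c i r - c j r|) /\
   \sum_(j | Q j) `|c j b - c j r| * (1 + 2 * M) <= 2^-1.

(** The homeomorphism [h] normalizes on each sphere the map that brings the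
    configuration of that sphere to the one of radius [b].  Inside the ball of
    radius [a] it is homogeneous and acts on the configuration of radius [a]
    only; this is why the motion below [a] is left for the next step. *)
Lemma shell_step (R : realType) (J : finType) (Q : pred J)
    (c : J -> R -> 'rV[R]_3) (a b : R) : 0 < a -> a < b ->
  (forall j r, Q j -> 0 < r -> `|c j r| = 1) ->
  (forall j r, Q j -> 0 < r -> {for r, continuous (c j)}) ->
  slow_shell Q c a b ->
  exists h : 'rV[R]_3 -> 'rV[R]_3, [/\ continuous h, injective h,
    forall y, exists x, h x = y, forall x, `|h x| = `|x| &
    (forall x, b <= `|x| -> h x = x) /\
    forall j r, Q j -> 0 <= r <= b -> h (r *: c j (Num.max a r)) = r *: c j b].
Proof.
move=> a0 ab c1 cc [M M0 HM].
(* The radius, truncated to [a, b]: the motion is frozen outside the shell. *)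
pose rho s := Num.max a (Num.min b s).
have rhoI s : a <= rho s <= b.
  by rewrite /rho le_max lexx ge_max ge_min lexx (ltW ab).
have rho0 s : 0 < rho s by case/andP: (rhoI s) => h _; lra.
pose C j s := c j (rho s).
pose G s := level_map Q M (fun j => c j b) (fun j => C j s).
have C1 s j : Q j -> `|C j s| = 1 by move=> Qj; apply: c1.
have Csep s i j : Q i -> Q j -> i != j -> 1 <= M * `|C i s - C j s|.
  by have [h _] := HM _ (rhoI s); exact: h.
have Csm s : \sum_(j | Q j) `|c j b - C j s| * (1 + 2 * M) <= 2^-1.
  by have [_ h] := HM _ (rhoI s).
have Ginj s := level_map_inj M0 (C1 s) (Csm s).
have Gsurj s := level_map_surj M0 (C1 s) (Csm s).
have G0 s (x : 'rV[R]_3) := level_map_eq0 M0 (C1 s) (Csm s) x.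
have GZ s (l : R) (x : 'rV[R]_3) : 0 <= l -> G s (l *: x) = l *: G s x.
  by move=> l0; exact: level_mapZ.
pose h (x : 'rV[R]_3) : 'rV[R]_3 := (`|x| / `|G `|x| x|) *: G `|x| x.
have Gn s x : x != 0 -> `|G s x| != 0 by move=> x0; rewrite normr_eq0 G0.
have hn x : `|h x| = `|x|.
  have [->|x0] := eqVneq x 0; first by rewrite /h normr0 mul0r scale0r normr0.
  by rewrite /h normrZ normrM normfV !normr_id divfK // Gn.
have h0 : h 0 = 0 by rewrite /h normr0 mul0r scale0r.
exists h; split => //.
- have crho : continuous rho.
    apply: (@continuous_lipschitz R R R _ 1) => x y; rewrite mul1r /rho.
    exact: le_trans (max_lip _ _ _) (min_lip _ _ _).
  have cn : continuous (fun x : 'rV[R]_3 => `|x|) by exact: norm_continuous.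
  have cid : continuous (fun x : 'rV[R]_3 => x) by move=> x; exact: cvg_id.
  have cC j : Q j -> continuous (fun x : 'rV[R]_3 => C j `|x|).
    move=> Qj x; apply: (@continuous_comp _ _ _ (fun x : 'rV[R]_3 => rho `|x|) (c j)); last exact: cc.
    by apply: (@continuous_comp _ _ _ (fun x : 'rV[R]_3 => `|x|) rho); [exact: cn|exact: crho].
  have cG : continuous (fun x : 'rV[R]_3 => G `|x| x).
    apply: continuous_add => //; apply: continuous_sum => j Qj.
    apply: continuous_scale; last first.
      by apply: continuous_sub; [exact: cst_continuous|exact: cC].
    move=> x; apply: (@continuous_comp _ _ _ (fun x : 'rV[R]_3 => `|x| - M * `|x - `|x| *: C j `|x| |) (Num.max 0)).
      apply: continuous_sub => //.
      apply: (@continuous_scale R _ R (fun=> M)); first exact: cst_continuous.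
      apply: continuous_norm; apply: continuous_sub => //.
      by apply: continuous_scale => //; exact: cC.
    by apply: (@continuous_lipschitz R R R _ 1) => u v; rewrite mul1r; exact: max_lip.
  move=> x; have [->|x0] := eqVneq x 0.
    apply/(@continuous_at_epsP R 'rV[R]_3 'rV[R]_3) => e e0; exists e => // y.
    by rewrite h0 !subr0 hn.
  have cV := @cvgV R _ (nbhs x) _ (fun y : 'rV[R]_3 => `|G `|y| y|) _ (Gn _ _ x0)
    (continuous_norm cG (x := x)).
  have cM := @cvgM R _ (nbhs x) _ (fun y : 'rV[R]_3 => `|y|) _ _ _ (cn x) (cV _).
  have cZ := @cvgZ R _ _ (nbhs x) _ (fun y : 'rV[R]_3 => `|y| / `|G `|y| y|)
    _ _ _ (cM _ _) (cG x).
  exact: (cZ _).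
- move=> x y E.
  have nE : `|x| = `|y| by rewrite -(hn x) E hn.
  have [x0|x0] := eqVneq x 0.
    by move/eqP: nE; rewrite x0 normr0 eq_sym normr_eq0 => /eqP ->.
  have y0 : y != 0 by rewrite -normr_eq0 -nE normr_eq0.
  have nx : 0 < `|x| by rewrite normr_gt0.
  have hE (z : 'rV[R]_3) : `|z| = `|x| ->
      h z = G `|x| ((`|x| / `|G `|x| z|) *: z).
    by move=> zx; rewrite /h zx GZ // divr_ge0.
  have pos (z : 'rV[R]_3) : z != 0 -> 0 < `|x| / `|G `|x| z|.
    by move=> z0; rewrite divr_gt0 // lt_def Gn // normr_ge0.
  have collinear (l m : R) : 0 < l -> 0 < m -> l *: x = m *: y -> x = y.
    move=> l0 m0 lm; have := congr1 (fun z : 'rV[R]_3 => `|z|) lm.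
    rewrite !normrZ -nE (gtr0_norm l0) (gtr0_norm m0) => /(mulIf (lt0r_neq0 nx)) elm.
    by move: lm; rewrite elm => /scalerI; apply; exact: lt0r_neq0.
  move: E; rewrite (hE x) // (hE y) // => /Ginj.
  exact: collinear (pos x x0) (pos y y0).
- move=> z; have [->|z0] := eqVneq z 0; first by exists 0.
  have [y yz] := Gsurj `|z| z.
  have y0 : y != 0 by have := G0 `|z| y; rewrite yz (negbTE z0) => /esym/negbT.
  have nz : 0 < `|z| by rewrite normr_gt0.
  have ny : 0 < `|y| by rewrite normr_gt0.
  exists ((`|z| / `|y|) *: y).
  have nE : `|(`|z| / `|y|) *: y| = `|z|.
    by rewrite normrZ gtr0_norm ?divr_gt0 // divfK // lt0r_neq0.
  rewrite /h nE GZ ?divr_ge0 // [G _ _]yz normrZ gtr0_norm ?divr_gt0 // scalerA.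
  rewrite (_ : _ * _ = 1) ?scale1r //; field.
  by rewrite !lt0r_neq0.
- split.
    move=> x bx; have x0 : x != 0 by rewrite -normr_gt0; apply: lt_le_trans bx; lra.
    have E : rho `|x| = b.
      by rewrite /rho (min_idPl bx); apply/max_idPr; exact: ltW.
    have GE : G `|x| x = x.
      rewrite /G /level_map big1 ?addr0 // => j _.
      by rewrite /C E subrr scaler0.
    by rewrite /h GE divff ?scale1r // normr_eq0.
  move=> j r Qj /andP[r0 rb].
  have r' : 0 < Num.max a r by rewrite lt_max a0.
  have nE : `|r *: c j (Num.max a r)| = r by rewrite normrZ c1 // mulr1 ger0_norm.
  rewrite /h nE GZ //.
  have -> : c j (Num.max a r) = C j r by rewrite /C /rho (min_idPr rb).
  have GE : G r (C j r) = c j b.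
    exact: (@level_map_on _ _ Q M (fun j => c j b) _ (C1 r) (Csep r) _ Qj).
  rewrite GE.
  rewrite normrZ c1 //; last by lra.
  have [->|r1] := eqVneq r 0; first by rewrite !scale0r scaler0.
  by rewrite mulr1 ger0_norm // divff // scale1r.
Qed.

Lemma slow_shell_local (R : realType) (J : finType) (Q : pred J)
    (c : J -> R -> 'rV[R]_3) (r0 : R) :
  (forall j r, Q j -> 0 < r -> {for r, continuous (c j)}) ->
  (forall i j r, Q i -> Q j -> 0 < r <= r0 -> i != j -> c i r != c j r) ->
  forall r, 0 < r <= r0 -> exists2 d, 0 < d & forall a b, r - d < a -> a < b ->
     b < r + d -> 0 < a -> b <= r0 -> slow_shell Q c a b.
Proof.
move=> cc cne r hr; have /andP[r_gt0 rr0] := hr.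
(* The diagonal terms vanish, because 2 / 0 = 0. *)
pose M := \sum_(p : J * J) 2 / `|c p.1 r - c p.2 r|.
have M0 : 0 <= M by apply: sumr_ge0 => p _; rewrite divr_ge0.
have MP i j : Q i -> Q j -> i != j -> 2 <= M * `|c i r - c j r|.
  move=> Qi Qj ij; have np : 0 < `|c i r - c j r| by rewrite normr_gt0 subr_eq0 cne.
  rewrite -ler_pdivrMr // /M (bigD1 (i, j)) //= lerDl.
  by apply: sumr_ge0 => p _; rewrite divr_ge0.
pose N : R := #|J|%:R.
have N0 : 0 <= N by rewrite ler0n.
have K0 : 0 < 4 * (N + 1) * (1 + 2 * M) by rewrite !mulr_gt0 //; lra.
(* Motions smaller than [eta] leave half of the distances between the points,
   and their sum over the points fulfils the bound of [slow_shell]. *)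
pose eta := (4 * (N + 1) * (1 + 2 * M))^-1.
have eta0 : 0 < eta by rewrite invr_gt0.
have etaE : eta * (4 * (N + 1) * (1 + 2 * M)) = 1 by rewrite mulVf // lt0r_neq0.
have [||d d0 Hd] := @finite_uniform_pos R J
  (fun j d => Q j -> forall s, `|s - r| < d -> `|c j s - c j r| < eta).
- by move=> j m m' _ mm H Qj s sr; apply: H => //; exact: lt_le_trans mm.
- move=> j; have [Qj|nQ] := boolP (Q j); last by exists 1.
  have /(continuous_at_epsP _ _) /(_ _ eta0) [d d0 Hd] := cc j r Qj r_gt0.
  by exists d.
have NM : 0 <= eta * N by rewrite mulr_ge0 // ltW.
have EM : 0 <= eta * M by rewrite mulr_ge0 // ltW.
have ENM : 0 <= eta * N * M by rewrite mulr_ge0.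
exists d => // a b ra ab bd a0 br0; exists M => // s /andP[as_ sb].
have near u : a <= u <= b -> `|u - r| < d.
  by move=> /andP[au ub]; rewrite ltr_norml; apply/andP; split; lra.
have hs : `|s - r| < d by apply: near; rewrite as_ sb.
have hb : `|b - r| < d by apply: near; rewrite lexx (ltW ab).
split.
- move=> i j Qi Qj ij; have h := MP i j Qi Qj ij.
  have hi := ltW (Hd i Qi s hs); have hj := ltW (Hd j Qj s hs).
  have tri : `|c i r - c j r| <= `|c i s - c j s| + `|c i s - c i r| + `|c j s - c j r|.
    have -> : c i r - c j r = (c i s - c j s) - (c i s - c i r) + (c j s - c j r) by vring.
    apply: le_trans (ler_normD _ _) _; rewrite lerD2r.
    exact: ler_normB.
  have h1 := ler_wpM2l M0 hi; have h2 := ler_wpM2l M0 hj; have h3 := ler_wpM2l M0 tri.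
  by move: etaE; nra.
- apply: le_trans (_ : \sum_(j : J) (2 * eta * (1 + 2 * M)) <= _).
    apply: le_trans (_ : \sum_(j | Q j) (2 * eta * (1 + 2 * M)) <= _).
      apply: ler_sum => j Qj; rewrite ler_wpM2r //; first by lra.
      have h1 := Hd j Qj s hs; have h2 := Hd j Qj b hb.
      have -> : c j b - c j s = (c j b - c j r) - (c j s - c j r) by vring.
      by apply: le_trans (ler_normB _ _) _; lra.
    rewrite big_mkcond /=; apply: ler_sum => j _; case: ifP => // _.
    by rewrite mulr_ge0 //; lra.
  rewrite sumr_const -[leLHS]mulr_natr -/N.
  by move: etaE; nra.
Qed.

(** The composite of the [shell_step] homeomorphisms along a sequence of radii that
    decreases to 0.  No uniform bound on the motion is available near 0, hence
    the adaptive choice of the radii by [greedy_sequence]. *)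
Lemma untwist (R : realType) (J : finType) (Q : pred J)
    (c : J -> R -> 'rV[R]_3) (r0 : R) : 0 < r0 ->
  (forall j r, Q j -> 0 < r -> `|c j r| = 1) ->
  (forall j r, Q j -> 0 < r -> {for r, continuous (c j)}) ->
  (forall i j r, Q i -> Q j -> 0 < r <= r0 -> i != j -> c i r != c j r) ->
  exists Psi : 'rV[R]_3 -> 'rV[R]_3, [/\ continuous Psi, injective Psi,
    forall y, exists x, Psi x = y, forall x, `|Psi x| = `|x| &
    (forall x, r0 <= `|x| -> Psi x = x) /\
    forall j r, Q j -> 0 <= r <= r0 -> Psi (r *: c j r) = r *: c j r0].
Proof.
move=> r00 c1 cc cne.
have [s [s00 s0 sd sg sx]] := greedy_sequence r00 (slow_shell_local cc cne).
have [h Hh] := choice (fun n => shell_step (s0 n.+1) (sd n) c1 cc (sg n)).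
have hc n : continuous (h n) by have [] := Hh n.
have hi n : injective (h n) by have [] := Hh n.
have hs n y : exists x, h n x = y by have [_ _ h' _ _] := Hh n; exact: h'.
have hn n x : `|h n x| = `|x| by have [_ _ _ h' _] := Hh n; exact: h'.
have hf n x : s n <= `|x| -> h n x = x by have [_ _ _ _ [h' _]] := Hh n; exact: h'.
have [Psi [Pc Pi Ps Pn PE]] := infinite_composition s0 sd sx hc hi hs hn hf.
exists Psi; split => //; split.
  by move=> x rx; rewrite (PE 0%N) // s00.
have ray n j r : Q j -> 0 < r <= r0 ->
    comp_upto h n (r *: c j (Num.max (s n) r)) = r *: c j r0.
  move=> Qj /andP[r_gt0 rr0]; elim: n => [|n IH].
    by rewrite /= s00 (max_idPl rr0).
  rewrite /= -IH; congr (comp_upto h n _).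
  have [rs|rs] := leP r (s n).
    have [_ _ _ _ [_ h']] := Hh n; rewrite h' ?rs ?ltW //.
  have r0' : 0 < Num.max (s n.+1) r by rewrite lt_max r_gt0 orbT.
  rewrite hf; last by rewrite normrZ c1 // mulr1 gtr0_norm // ltW.
  by rewrite (max_idPr (ltW (lt_trans (sd n) rs))).
move=> j r Qj /andP[]; rewrite le_eqVlt => /orP[/eqP <- _|r_gt0 rr0].
  by rewrite !scale0r; apply/eqP; rewrite -normr_eq0 Pn normr0.
have [n nr] := sx r r_gt0.
have := ray n j r Qj; rewrite r_gt0 rr0 (max_idPr nr) => /(_ isT) <-.
by apply: PE; rewrite normrZ c1 // mulr1 gtr0_norm.
Qed.

(** * Chains of intervals and polygonal arcs *)

(** Induction along an interval: the supremum of the [x] such that [P a x] can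
    neither be approached without being reached, nor be exceeded. *)
Lemma interval_chain (R : realType) (P : R -> R -> Prop) (a b : R) : a < b ->
  (forall x y z, a <= x -> x < y -> y < z -> z <= b -> P x y -> P y z -> P x z) ->
  (forall x, a <= x < b -> exists2 d, 0 < d &
     forall z, x < z -> z < x + d -> z <= b -> P x z) ->
  (forall x, a < x <= b -> exists2 d, 0 < d &
     forall z, x - d < z -> z < x -> a <= z -> P z x) ->
  P a b.
Proof.
move=> ab glue right left.
pose S := [set x | a < x <= b /\ P a x].
have beyond x : a <= x < b -> exists2 z, x < z <= b & P x z.
  move=> xb; have [d d0 Hd] := right x xb; case/andP: xb => ax xb.
  pose z := Num.min (x + d / 2) b.
  have zd : z <= x + d / 2 by rewrite ge_min lexx.
  have zb : z <= b by rewrite ge_min lexx orbT.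
  have xz : x < z by rewrite lt_min xb andbT; lra.
  by exists z; [rewrite xz zb|apply: Hd => //; lra].
have [z0 /andP[az0 zb0] Pz0] := beyond a (ltac:(by rewrite lexx ab)).
have Sub : has_ubound S by exists b => x [/andP[]].
have Ss : has_sup S by split; [exists z0; split => //; rewrite az0|].
pose m := sup S.
have Sm x : S x -> x <= m by move=> Sx; exact: (ub_le_sup Sub Sx).
have am : a < m by apply: (lt_le_trans az0); apply: Sm; split => //; rewrite az0.
have mb : m <= b by apply: ge_sup => [|x [/andP[]]]//; exists z0; split=> //; rewrite az0.
have Pm : P a m.
  have [d d0 Hd] := left m (ltac:(by rewrite am mb)).
  have [x Sx xm] := sup_adherent d0 Ss; have [/andP[ax xb] Px] := Sx.
  have := Sm x Sx; rewrite le_eqVlt => /orP[/eqP <- //|xltm].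
  by apply: (glue a x m) => //; apply: Hd => //; exact: ltW.
move: mb; rewrite le_eqVlt => /orP[/eqP <- //|mltb].
have [z /andP[mz zb] Pz] := beyond m (ltac:(by rewrite (ltW am) mltb)).
have : z <= m.
  by apply: Sm; split; [rewrite zb (lt_trans am mz)|apply: (glue a m z)].
by rewrite leNgt mz.
Qed.

Definition straight (R : realType) (f : R -> 'rV[R]_3) (a b : R) : Prop :=
  f @` `[a, b] = segment (f a) (f b).

Inductive chain (R : realType) (P : R -> R -> Prop) : R -> R -> Prop :=
| chain_one a b : a < b -> P a b -> chain P a b
| chain_cons a b c : a < b -> P a b -> chain P b c -> chain P a c.

Notation polyline f := (chain (straight f)).

Lemma chain_lt (R : realType) (P : R -> R -> Prop) a b : chain P a b -> a < b.
Proof. by elim=> // {}a c {}b ac _ _; exact: lt_trans. Qed.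

Lemma chain_trans (R : realType) (P : R -> R -> Prop) a b c :
  chain P a b -> chain P b c -> chain P a c.
Proof.
elim=> {a b} [a b ab Pab|a b d ab Pab _ IH] Pc; first exact: chain_cons Pc.
by apply: chain_cons (IH Pc).
Qed.

Lemma chain_subdivision (R : realType) (P : R -> R -> Prop) a b :
  chain P a b -> exists2 s, path <%R a (rcons s b) &
    let u := a :: rcons s b in
    forall k : nat, (k <= size s)%N -> P u`_k u`_k.+1.
Proof.
elim=> {a b} [a b ab fab|a b c ab fab _ [s ps Hs]].
  by exists [::]; rewrite /= ?ab // => -[|k].
exists (b :: s); first by rewrite /= ab.
by move=> u [_|k ks]; [exact: fab|exact: (Hs k ks)].
Qed.

Lemma subdivision_chain (R : realType) (P : R -> R -> Prop) s a b :
  (let u := a :: rcons s b in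
    forall k : nat, (k <= size s)%N -> chain P u`_k u`_k.+1) -> chain P a b.
Proof.
elim: s a => [|x s IH] a H; first exact: (H 0%N).
apply: (@chain_trans _ _ _ x); first exact: (H 0%N).
by apply: IH => u k ks; exact: (H k.+1).
Qed.

Lemma straight_ext (R : realType) (f g : R -> 'rV[R]_3) a b : a <= b ->
  (forall t, a <= t <= b -> f t = g t) -> straight f a b -> straight g a b.
Proof.
move=> ab fg; rewrite /straight => H.
rewrite -(fg a) ?lexx ?ab // -(fg b) ?lexx ?ab // -H.
by apply/seteqP; split => _ [t tab <-]; exists t => //; rewrite fg //;
  move: tab; rewrite /= in_itv.
Qed.

Lemma polyline_ext (R : realType) (f g : R -> 'rV[R]_3) a b :
  (forall t, a <= t <= b -> f t = g t) -> polyline f a b -> polyline g a b.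
Proof.
move=> fg H; elim: H fg => {a b} [a b ab fab fg|a b c ab fab fbc IH fg].
  by apply: chain_one => //; apply: straight_ext fab => //; exact: ltW.
have bc := chain_lt fbc.
apply: (chain_cons ab).
  apply: straight_ext fab; first exact: ltW.
  by move=> t /andP[h1 h2]; apply: fg; rewrite h1 (le_trans h2) // ltW.
by apply: IH => t /andP[h1 h2]; rewrite fg // h2 (le_trans (ltW ab)).
Qed.

Lemma polyline_affine (R : realType) (f : R -> 'rV[R]_3) u v a b : u < v ->
  polyline (fun t => f (u + t * (v - u))) a b ->
  polyline f (u + a * (v - u)) (u + b * (v - u)).
Proof.
move=> uv; have uv0 : 0 < v - u by rewrite subr_gt0.
have str x y : x < y -> straight (fun t => f (u + t * (v - u))) x y ->
    straight f (u + x * (v - u)) (u + y * (v - u)).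
  move=> xy; rewrite /straight => <-; apply/seteqP; split => _ [t /= tI <-].
    exists ((t - u) / (v - u)) => /=; last by rewrite divfK ?lt0r_neq0 // subrKC.
    move: tI; rewrite !in_itv /= ler_pdivlMr // ler_pdivrMr //.
    by rewrite lerBrDl lerBlDl.
  exists (u + t * (v - u)) => //=; move: tI; rewrite !in_itv /=.
  by rewrite !lerD2l !ler_pM2r.
have lt x y : x < y -> u + x * (v - u) < u + y * (v - u).
  by move=> xy; rewrite ltrD2l ltr_pM2r.
elim=> {a b} [a b ab fab|a b c ab fab _ IH].
  by apply: chain_one; [exact: lt|exact: str].
by apply: chain_cons IH; [exact: lt|exact: str].
Qed.

Lemma straightP (R : realType) (f : R -> 'rV[R]_3) (th : R -> R) a b :
  a < b -> continuous th -> th a = 0 -> th b = 1 ->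
  (forall t, a <= t <= b -> 0 <= th t <= 1 /\ f t = f a + th t *: (f b - f a)) ->
  straight f a b.
Proof.
move=> ab cth tha thb H; apply/seteqP; split => x /=.
  move=> [t]; rewrite /= in_itv /= => tab <-; have [t01 ->] := H t tab.
  by exists (th t) => //; vring.
move=> [k]; rewrite /= in_itv /= => k01 <-.
have [||t] := @IVT R th a b k (ltW ab).
- exact: continuous_subspaceT.
- by rewrite tha thb minEle maxEle ler01.
rewrite in_itv /= => tab tk; exists t; first by rewrite /= in_itv.
by have [_ ->] := H t tab; rewrite tk; vring.
Qed.

(** * Replacing arcs by inscribed polygons *)

(** [D] is the displacement from the arc [f] to a polygon with the same ends.  It is
    measured against the level function [X], which increases along the arc:
    this form of the Lipschitz condition passes to concatenations.  The
    condition on [lo] and [hi] records where the arc is left unchanged. *)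
Definition small_interpolation (R : realType) (f : R -> 'rV[R]_3) (X : R -> R)
    (lo hi delta a b : R) : Prop :=
  exists2 D : R -> 'rV[R]_3, polyline (fun t => f t - D t) a b &
  [/\ D a = 0, D b = 0, forall t, ~~ (lo <= t <= hi) -> D t = 0,
      forall t, a <= t <= b -> `|D t| <= delta &
      forall s t, a <= s -> s <= t -> t <= b -> `|D t - D s| <= 2^-1 * (X t - X s)].

Lemma small_interpolation_trans (R : realType) (f : R -> 'rV[R]_3) (X : R -> R)
    (lo hi delta a b c : R) :
  small_interpolation f X lo hi delta a b -> small_interpolation f X lo hi delta b c ->
  small_interpolation f X lo hi delta a c.
Proof.
move=> [D1 p1 [D1a D1b D1o D1d D1L]] [D2 p2 [D2a D2b D2o D2d D2L]].
have ab := chain_lt p1; have bc := chain_lt p2.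
pose D t := if t <= b then D1 t else D2 t.
have DE1 t : t <= b -> D t = D1 t by rewrite /D => ->.
have DE2 t : b <= t -> D t = D2 t.
  by rewrite /D; case: (ltgtP t b) => // -> _; rewrite D1b D2a.
exists D.
  apply: (@chain_trans _ _ _ b).
    by apply: polyline_ext p1 => t /andP[_ tb]; rewrite DE1.
  by apply: polyline_ext p2 => t /andP[tb _]; rewrite DE2.
split.
- by rewrite DE1 ?D1a // ltW.
- by rewrite DE2 ?D2b // ltW.
- by move=> t tl; rewrite /D; case: ifP => _; [exact: D1o|exact: D2o].
- move=> t /andP[h1 h2]; have [tb|tb] := leP t b.
    by rewrite DE1 // D1d // h1.
  by rewrite DE2 ?D2d ?h2 ?ltW.
move=> s t as_ st tc.
have [tb|bt] := leP t b.
  by rewrite !DE1 ?D1L // (le_trans st).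
have [bs|sb] := leP b s.
  by rewrite !DE2 ?D2L // ltW.
have := D1L s b as_ (ltW sb) (lexx b); have := D2L b t (lexx b) (ltW bt) tc.
rewrite (DE2 t (ltW bt)) (DE1 s (ltW sb)) D1b D2a => h1 h2.
have -> : D2 t - D1 s = (D2 t - 0) + (0 - D1 s) by vring.
by apply: le_trans (ler_normD _ _) _; lra.
Qed.

Lemma small_interpolation_straight (R : realType) (f : R -> 'rV[R]_3) (X : R -> R)
    (lo hi delta a b : R) : 0 <= delta -> a < b -> straight f a b ->
  (forall s t, a <= s -> s <= t -> t <= b -> X s <= X t) ->
  small_interpolation f X lo hi delta a b.
Proof.
move=> d0 ab fab Xm; exists (fun=> 0).
  by apply: polyline_ext (chain_one ab fab) => t _; rewrite subr0.
split => // [t _|s t h1 h2 h3]; first by rewrite normr0.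
by rewrite subrr normr0 mulr_ge0 // ?subr_ge0 ?Xm // invr_ge0.
Qed.

(** The arc is nearly a straight line of direction [v], parametrized by [X]. *)
Definition steep (R : realType) (f : R -> 'rV[R]_3) (X : R -> R) (v : 'rV[R]_3)
    (a b : R) := forall s t, a <= s -> s < t -> t <= b ->
  0 < X t - X s /\ `|f t - f s - (X t - X s) *: v| <= 4^-1 * (X t - X s).

(** [D] compares the arc with its chord at the same level of [X].  Both have nearly
    the direction [v], so that the difference grows at most half as fast as
    [X]. *)
Lemma small_interpolation_chord (R : realType) (f : R -> 'rV[R]_3) (X : R -> R) v
    (lo hi delta a b : R) : a < b -> lo <= a -> b <= hi -> continuous X ->
  steep f X v a b -> X b - X a <= 2 * delta ->
  small_interpolation f X lo hi delta a b.
Proof.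
move=> ab loa bhi cX st Xd.
have [Xab chord] := st a b (lexx a) ab (lexx b).
have Xab0 : X b - X a != 0 by exact: lt0r_neq0.
pose th t := (X t - X a) / (X b - X a).
have tha : th a = 0 by rewrite /th subrr mul0r.
have thb : th b = 1 by rewrite /th divff.
pose D0 t := f t - f a - th t *: (f b - f a).
pose D t := if a <= t <= b then D0 t else 0.
have DE t : a <= t <= b -> D t = D0 t by rewrite /D => ->.
have aI : a <= a <= b by rewrite lexx ltW.
have bI : a <= b <= b by rewrite lexx ltW.
have Da : D a = 0 by rewrite DE // /D0 tha; vring.
have Db : D b = 0 by rewrite DE // /D0 thb; vring.
have mono s t : a <= s -> s <= t -> t <= b -> X s <= X t.
  move=> as_; rewrite le_eqVlt => /orP[/eqP -> //|st'] tb.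
  by have [h _] := st s t as_ st' tb; lra.
have DL s t : a <= s -> s <= t -> t <= b -> `|D t - D s| <= 2^-1 * (X t - X s).
  move=> as_ st' tb; rewrite !DE; last 2 first.
  - by rewrite as_ (le_trans st').
  - by rewrite tb (le_trans as_).
  move: st'; rewrite le_eqVlt => /orP[/eqP ->|st']; first by rewrite !subrr normr0 mulr0.
  have [X0 h] := st s t as_ st' tb.
  pose l := (X t - X s) / (X b - X a).
  have l0 : 0 < l by rewrite divr_gt0.
  have lE : X t - X s = l * (X b - X a) by rewrite /l divfK.
  have -> : D0 t - D0 s = (f t - f s - (X t - X s) *: v)
      - l *: (f b - f a - (X b - X a) *: v).
    have thE : th t = th s + l by rewrite /th /l; ring.
    by rewrite /D0 thE lE; vring.
  apply: le_trans (ler_normB _ _) _; rewrite normrZ (gtr0_norm l0).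
  by have := ler_wpM2l (ltW l0) chord; nra.
exists D.
  apply: chain_one => //; apply: (@straightP _ _ th) => //.
    move=> x; have -> : th = fun t => (X b - X a)^-1 *: (X t - X a) :> R.
      by apply/funext => t; rewrite /th mulrC.
    apply: (@continuous_scale R _ R (fun=> (X b - X a)^-1)); first exact: cst_continuous.
    by apply: (@continuous_sub R _ R) => //; exact: cst_continuous.
  move=> t tab; have /andP[at_ tb] := tab; split.
    rewrite /th divr_ge0 ?(ltW Xab) ?subr_ge0 ?mono //=.
    by rewrite ler_pdivrMr // mul1r lerD2r mono.
  by rewrite Da Db !subr0 DE // /D0; vring.
split => //.
- move=> t tl; rewrite /D; case: ifP => // /andP[at_ tb]; move/negP: tl; case.
  by rewrite (le_trans loa) // (le_trans tb).
- move=> t /andP[at_ tb]; have := DL a t (lexx a) at_ tb; rewrite Da subr0.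
  by have := mono t b at_ tb (lexx b); lra.
Qed.

(** Only the middle part of the arc is replaced, by a polygon so fine that [X]
    varies by at most [2 * delta] along each of its edges. *)
Lemma small_interpolation_arc (R : realType) (f : R -> 'rV[R]_3) (X : R -> R) v
    (lo hi delta a b : R) : 0 < delta -> a < lo -> lo < hi -> hi < b ->
  continuous X -> straight f a lo -> straight f hi b -> steep f X v lo hi ->
  (forall s t, a <= s -> s <= t -> t <= lo -> X s <= X t) ->
  (forall s t, hi <= s -> s <= t -> t <= b -> X s <= X t) ->
  small_interpolation f X lo hi delta a b.
Proof.
move=> d0 alo lohi hib cX s1 s2 st m1 m2.
apply: (@small_interpolation_trans _ _ _ _ _ _ _ lo).
  by apply: small_interpolation_straight => //; exact: ltW.
apply: (@small_interpolation_trans _ _ _ _ _ _ _ hi); last first.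
  by apply: small_interpolation_straight => //; exact: ltW.
have sub x y : lo <= x -> y <= hi -> steep f X v x y.
  move=> lx yh s t h1 h2 h3; apply: st => //; last exact: le_trans yh.
  exact: le_trans h1.
have loc x : exists2 d, 0 < d & forall y, `|y - x| < d -> `|X y - X x| < delta.
  exact: (@continuous_epsP R R R X).1.
apply: interval_chain => //.
- by move=> x y z _ _ _ _; exact: small_interpolation_trans.
- move=> x /andP[lx xh]; have [d dd Hd] := loc x; exists d => // z xz zx zh.
  apply: (@small_interpolation_chord _ _ _ v) => //; first exact: sub.
  have := Hd z; rewrite ger0_norm; last by lra.
  by move=> /(_ ltac:(lra)) h; have := ler_norm (X z - X x); lra.
- move=> x /andP[lx xh]; have [d dd Hd] := loc x; exists d => // z xz zx lz.
  apply: (@small_interpolation_chord _ _ _ v) => //; first exact: sub.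
  have := Hd z; rewrite ler0_norm; last by lra.
  by move=> /(_ ltac:(lra)) h; have := ler_norm (X x - X z); rewrite distrC; lra.
Qed.

(** The displacements of the arcs form a contraction on the union of the arcs.  For
    points of distinct arcs, a nonzero displacement occurs only if one of them is
    in the middle part of its arc, where the distance is at least [m] and both
    displacements are at most [m / 4]. *)
Lemma polygonalize (R : realType) (I : finType) (f : I -> R -> 'rV[R]_3)
    (X : I -> R -> R) (v : I -> 'rV[R]_3) (lo hi : I -> R) (m : R) : 0 < m ->
  (forall i, 0 < lo i) -> (forall i, lo i < hi i) -> (forall i, hi i < 1) ->
  (forall i, continuous (X i)) ->
  (forall i s t, X i t - X i s <= `|f i t - f i s|) ->
  (forall i, straight (f i) 0 (lo i)) -> (forall i, straight (f i) (hi i) 1) ->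
  (forall i, steep (f i) (X i) (v i) (lo i) (hi i)) ->
  (forall i s t, 0 <= s -> s <= t -> t <= lo i -> X i s <= X i t) ->
  (forall i s t, hi i <= s -> s <= t -> t <= 1 -> X i s <= X i t) ->
  (forall i j s t, i != j -> lo i <= s <= hi i -> 0 <= t <= 1 ->
     m <= `|f i s - f j t|) ->
  exists Psi : 'rV[R]_3 -> 'rV[R]_3, [/\ continuous Psi, injective Psi,
    forall y, exists x, Psi x = y, exists C, forall x, `|Psi x - x| <= C &
    forall i, polyline (fun t => Psi (f i t)) 0 1].
Proof.
move=> m0 lo0 lohi hi1 cX Xf s1 s2 st m1 m2 gap.
pose delta := m / 4.
have d0 : 0 < delta by rewrite divr_gt0.
have [D HD] := choice (fun i => (ltac:(
  have [D h1 h2] := small_interpolation_arc d0 (lo0 i) (lohi i) (hi1 i) (cX i) (s1 i) (s2 i) (st i)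
    (@m1 i) (@m2 i); exists D; exact: (conj h1 h2)) : exists D, _ /\ _)).
(* The points of the arcs, indexed by their arc and their parameter. *)
pose Z := {p : I * R | 0 <= p.2 <= 1}.
pose q (z : Z) := f (sval z).1 (sval z).2.
pose E (z : Z) := D (sval z).1 (sval z).2.
have EB z : `|E z| <= delta.
  by case: z => -[i t] /= t01; have [_ [_ _ _ h _]] := HD i; exact: h.
have same i s t : 0 <= s -> s <= t -> t <= 1 ->
    `|D i t - D i s| <= 2^-1 * `|f i t - f i s|.
  move=> h1 h2 h3; have [_ [_ _ _ _ h]] := HD i; apply: le_trans (h _ _ h1 h2 h3) _.
  by rewrite ler_pM2l // invr_gt0.
have diff i j s t : i != j -> 0 <= s <= 1 -> 0 <= t <= 1 ->
    `|D i s - D j t| <= 2^-1 * `|f i s - f j t|.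
  move=> ij s01 t01.
  have Ds := EB (exist (fun p : I * R => 0 <= p.2 <= 1) (i, s) s01).
  have Dt := EB (exist (fun p : I * R => 0 <= p.2 <= 1) (j, t) t01).
  rewrite /E /= in Ds Dt.
  have main : m <= `|f i s - f j t| -> `|D i s - D j t| <= 2^-1 * `|f i s - f j t|.
    by move=> h; apply: le_trans (ler_normB _ _) _; move: Ds Dt; rewrite /delta; lra.
  have [sI|sI] := boolP (lo i <= s <= hi i); first exact/main/gap.
  have [tI|tI] := boolP (lo j <= t <= hi j).
    by apply: main; rewrite distrC; apply: gap => //; rewrite eq_sym.
  have [_ [_ _ hi_ _ _]] := HD i; have [_ [_ _ hj _ _]] := HD j.
  by rewrite hi_ // hj // subrr normr0 mulr_ge0 // invr_ge0.
have EL z z' : `|E z - E z'| <= 2^-1 * `|q z - q z'|.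
  case: z => -[i s] /= s01; case: z' => -[j t] /= t01; rewrite /E /q /=.
  have [<-|ij] := eqVneq i j; last exact: diff.
  case/andP: s01 => s0 s1'; case/andP: t01 => t0 t1.
  by have [h|h] := leP s t; [rewrite distrC (distrC (f i s))|]; apply: same => //; exact: ltW.
have [g [gL gB gE]] := lipschitz_extension_rV (ltac:(by rewrite invr_ge0) : 0 <= 2^-1 :> R) (ltW d0) EB EL.
have gL' x y : `|- g x - - g y| <= 2^-1 * `|x - y|.
  have -> : - g x - - g y = - (g x - g y) by vring.
  by rewrite normrN; exact: gL.
have [Pi Ps] := id_add_contraction_bij gL'.
exists (fun x => x - g x); split => //.
- apply: continuous_sub; first by move=> x; exact: cvg_id.
  exact: continuous_lipschitz gL.
- by exists delta => x; rewrite addrAC subrr sub0r normrN.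
move=> i; have [p _] := HD i; apply: polyline_ext p => t t01.
by have := gE (exist (fun p : I * R => 0 <= p.2 <= 1) (i, t) t01); rewrite /q /E /= => ->.
Qed.

(** * Straightening a network of nearly straight arcs *)

(** The constant is small enough for the arc to be [steep] with respect to a
    coordinate. *)
Definition nearly_straight (R : realType) (g : R -> 'rV[R]_3) (v : 'rV[R]_3) :=
  forall s t, 0 <= s -> s < t -> t <= 1 ->
  0 < `|g t - g s| /\ `|g t - g s - `|g t - g s| *: v| <= 16^-1 * `|g t - g s|.

Lemma nearly_straight_rev (R : realType) (g : R -> 'rV[R]_3) v :
  nearly_straight g v -> nearly_straight (fun t => g (1 - t)) (- v).
Proof.
move=> H s t s0 st t1; have [||| h1 h2] := H (1 - t) (1 - s); try by lra.
rewrite distrC; split => //; apply: le_trans h2.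
rewrite le_eqVlt; apply/orP; left; apply/eqP.
rewrite -normrN; congr `|_|; vring.
Qed.

(** The distance to the initial point increases at least half as fast as the arc moves.
    Writing [g t - g 0] as [x + h], both vectors nearly have the direction of
    [v], so that [h] is nearly a positive multiple of [x]. *)
Lemma nearly_straight_mono (R : realType) (g : R -> 'rV[R]_3) v :
  nearly_straight g v -> forall s t, 0 <= s -> s <= t -> t <= 1 ->
  2^-1 * `|g t - g s| <= `|g t - g 0| - `|g s - g 0|.
Proof.
move=> H s t s0; rewrite le_eqVlt => /orP[/eqP -> _|st t1].
  by rewrite !subrr normr0 mulr0.
move: s0; rewrite le_eqVlt => /orP[/eqP <-|s0].
  by rewrite (subrr (g 0)) normr0 subr0; have := normr_ge0 (g t - g 0); lra.
have [x0 hx] := H 0 s (lexx 0) s0 (ltW (lt_le_trans st t1)).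
have [h0 hh] := H s t (ltW s0) st t1.
set x := g s - g 0 in x0 hx *; set h := g t - g s in h0 hh *.
have -> : g t - g 0 = x + h by rewrite /x /h; vring.
pose r := `|h| / `|x|; have r0 : 0 < r by rewrite divr_gt0.
have rE : r * `|x| = `|h| by rewrite /r divfK // lt0r_neq0.
have := lerB_dist ((1 + r) *: x) ((1 + r) *: x - (x + h)).
have -> : (1 + r) *: x - ((1 + r) *: x - (x + h)) = x + h by vring.
rewrite normrZ gtr0_norm; last by lra.
have E : (1 + r) *: x - (x + h) = r *: (x - `|x| *: v) - (h - `|h| *: v).
  by rewrite -rE; vring.
have : `|(1 + r) *: x - (x + h)| <= r * `|x - `|x| *: v| + `|h - `|h| *: v|.
  rewrite E; apply: le_trans (ler_normB _ _) _.
  by rewrite normrZ (gtr0_norm r0).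
have := ler_wpM2l (ltW r0) hx.
by move: rE; nra.
Qed.

Lemma radial_param (R : realType) (g : R -> 'rV[R]_3) v (r0 : R) :
  continuous g -> nearly_straight g v -> 0 < r0 -> r0 < `|g 1 - g 0| ->
  exists tau : R -> R, forall r, 0 <= r <= r0 ->
    0 <= tau r < 1 /\ `|g (tau r) - g 0| = r.
Proof.
move=> cg ns r00 r01.
suff H r : exists t, 0 <= r <= r0 -> 0 <= t < 1 /\ `|g t - g 0| = r.
  by have [tau Ht] := choice H; exists tau.
have [/andP[h1 h2]|nr] := boolP (0 <= r <= r0); last by exists 0.
have [||t] := @IVT R (fun t => `|g t - g 0|) 0 1 r ler01.
- apply: continuous_subspaceT; apply: continuous_norm; apply: continuous_sub => //.
  exact: cst_continuous.
- by rewrite subrr normr0 minEle maxEle normr_ge0 h1 (le_trans h2 (ltW r01)).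
rewrite in_itv /= => /andP[t0 t1] tr; exists t => _; split => //.
rewrite t0 lt_neqAle t1 andbT; apply/eqP => E; move: tr; rewrite E => tr.
by move: r01; rewrite tr ltNge h2.
Qed.

(** In this section, [tau j r] is the parameter at which the arc [g j] meets the
    sphere of radius [r] around its initial point. *)
Section Vertex.
Variables (R : realType) (J : finType) (g : J -> R -> 'rV[R]_3) (v : J -> 'rV[R]_3) (r0 : R).
Variable tau : J -> R -> R.
Hypothesis ns : forall j, nearly_straight (g j) (v j).
Hypothesis r00 : 0 < r0.
Hypothesis tauP : forall j r, 0 <= r <= r0 ->
    0 <= tau j r < 1 /\ `|g j (tau j r) - g j 0| = r.
Hypothesis gne : forall i j s t, i != j -> g i 0 = g j 0 -> 0 < s < 1 -> 0 < t < 1 ->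
   g i s <> g j t.

(** The distance to the initial point grows at least half as fast as the arc moves. *)
Lemma radial_lip j r s : 0 <= r <= r0 -> 0 <= s <= r0 ->
  `|g j (tau j r) - g j (tau j s)| <= 2 * `|r - s|.
Proof.
have main a b : 0 <= a <= r0 -> 0 <= b <= r0 -> tau j a <= tau j b ->
    `|g j (tau j b) - g j (tau j a)| <= 2 * `|b - a|.
  move=> ha hb ab; have [/andP[a0 _] aE] := tauP j ha.
  have [/andP[_ b1] bE] := tauP j hb.
  have := nearly_straight_mono (@ns j) a0 ab (ltW b1); rewrite aE bE => h.
  by have := ler_norm (b - a); lra.
move=> hr hs; have [h|h] := leP (tau j s) (tau j r); first exact: main.
by rewrite distrC (distrC r); apply: main => //; exact: ltW.
Qed.

Lemma radial_unique j t : 0 <= t <= 1 -> `|g j t - g j 0| <= r0 ->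
  g j t = g j (tau j `|g j t - g j 0|).
Proof.
move=> /andP[t0 t1] tr; set r := `|_ - _| in tr *.
have [/andP[a0 a1] aE] := tauP j (ltac:(by rewrite normr_ge0 tr) : 0 <= r <= r0).
apply/eqP; rewrite -subr_eq0 -normr_eq0; apply/eqP.
have [h|h] := leP (tau j r) t.
  have := nearly_straight_mono (@ns j) a0 h t1; rewrite aE -/r.
  by have := normr_ge0 (g j t - g j (tau j r)); lra.
have := nearly_straight_mono (@ns j) t0 (ltW h) (ltW a1); rewrite aE -/r distrC.
by have := normr_ge0 (g j t - g j (tau j r)); lra.
Qed.

(** The configuration to be untwisted consists of the points where the arcs issued
    from [p] cross the spheres around [p].  It is extended by a constant motion
    beyond the radius [r0]. *)
Lemma untwist_vertex (p : 'rV[R]_3) :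
  exists Psi : 'rV[R]_3 -> 'rV[R]_3, [/\ continuous Psi, injective Psi,
    forall y, exists x, Psi x = y, forall x, `|Psi x - p| = `|x - p| &
    (forall x, r0 <= `|x - p| -> Psi x = x) /\
    forall j t, g j 0 = p -> 0 <= t <= 1 -> `|g j t - p| <= r0 ->
      Psi (g j t) = p + (`|g j t - p| / r0) *: (g j (tau j r0) - p)].
Proof.
pose Q j := g j 0 == p.
pose m r := Num.max 0 (Num.min r0 r).
have mI r : 0 <= m r <= r0 by rewrite /m le_max lexx ge_max ge_min lexx (ltW r00).
have mE r : 0 < r -> m r = Num.min r0 r.
  by move=> h; apply/max_idPr; rewrite le_min ltW //= ltW.
have m_gt0 r : 0 < r -> 0 < m r by move=> h; rewrite mE // lt_min r00.
have mr r : 0 < r -> r <= r0 -> m r = r by move=> h1 h2; rewrite mE //; apply/min_idPr.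
have cm : continuous m.
  apply: (@continuous_lipschitz R R R _ 1) => x y; rewrite mul1r.
  exact: le_trans (max_lip _ _ _) (min_lip _ _ _).
pose c j r := (m r)^-1 *: (g j (tau j (m r)) - p).
have c1 j r : Q j -> 0 < r -> `|c j r| = 1.
  move=> /eqP gp r_gt0; rewrite /c -gp normrZ gtr0_norm ?invr_gt0 ?m_gt0 //.
  by have [_ ->] := tauP j (mI r); rewrite mulVf // lt0r_neq0 // m_gt0.
have cg j : continuous (fun r => g j (tau j (m r)) - p).
  apply: continuous_sub; last exact: cst_continuous.
  apply: (@continuous_lipschitz R R _ _ 2) => x y; apply: le_trans (radial_lip _ (mI x) (mI y)) _.
  rewrite ler_pM2l //; exact: le_trans (max_lip _ _ _) (min_lip _ _ _).
have cc j r : Q j -> 0 < r -> {for r, continuous (c j)}.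
  move=> _ r_gt0.
  have cV := @cvgV R _ (nbhs r) _ m _ (lt0r_neq0 (m_gt0 r r_gt0)) (cm r).
  have cZ := @cvgZ R _ _ (nbhs r) _ _ _ _ _ (cV _) (cg j r).
  exact: (cZ _).
have pos j r : 0 < r <= r0 -> 0 < tau j r < 1.
  move=> /andP[h1 h2]; have [/andP[t0 ->] E] := tauP j (ltac:(by rewrite ltW) : 0 <= r <= r0).
  rewrite andbT lt_neqAle t0 andbT; apply/eqP => e0; move: E; rewrite -e0 subrr normr0.
  by move=> e; move: h1; rewrite -e ltxx.
have cne i j r : Q i -> Q j -> 0 < r <= r0 -> i != j -> c i r != c j r.
  move=> /eqP Qi /eqP Qj hr ij; have /andP[h1 h2] := hr; apply/eqP.
  rewrite /c mr // => /scalerI; rewrite invr_eq0 => /(_ (lt0r_neq0 h1)) /addIr.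
  by apply: gne; rewrite ?Qi ?Qj ?pos.
have [Psi [Pc Pi Ps Pn [Pf PE]]] := untwist r00 c1 cc cne.
exists (fun x => Psi (x - p) + p); split.
- apply: continuous_add; last exact: cst_continuous.
  move=> x; apply: (@continuous_comp _ _ _ (fun x : 'rV[R]_3 => x - p) Psi); last exact: Pc.
  by apply: continuous_sub => [y|]; [exact: cvg_id|exact: cst_continuous].
- by move=> x y /addIr /Pi /addIr.
- move=> y; have [x xy] := Ps (y - p); exists (x + p).
  by rewrite addrK xy subrK.
- by move=> x; rewrite addrK Pn.
split; first by move=> x rx; rewrite Pf // subrK.
move=> j t gp t01 tr; set r := `|_ - _| in tr *.
have rE : r = `|g j t - g j 0| by rewrite gp.
have := radial_unique t01 (ltac:(by rewrite -rE) : `|g j t - g j 0| <= r0).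
rewrite -rE => gE.
have r_ge0 : 0 <= r by exact: normr_ge0.
move: (r_ge0); rewrite le_eqVlt => /orP[/eqP re0|r_gt0].
  have -> : g j t - p = 0 by apply/eqP; rewrite -normr_eq0 -/r -re0.
  rewrite -re0 mul0r scale0r addr0 -[RHS]add0r; congr (_ + _).
  by apply/eqP; rewrite -normr_eq0 Pn normr0.
have := PE j r; rewrite /Q gp eqxx r_ge0 tr => /(_ isT isT).
rewrite /c !mr // !scalerA divff ?lt0r_neq0 // scale1r -gE => ->.
by rewrite addrC.
Qed.
End Vertex.

(** Homeomorphisms that act inside disjoint balls, and preserve these balls, do not
    interfere: they are simply composed. *)
Lemma disjoint_supports (R : realType) (r0 : R) (ps : seq 'rV[R]_3)
    (Psi : 'rV[R]_3 -> 'rV[R]_3 -> 'rV[R]_3) : 0 < r0 -> uniq ps ->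
  (forall p q, p \in ps -> q \in ps -> p != q -> 2 * r0 < `|p - q|) ->
  (forall p, continuous (Psi p)) -> (forall p, injective (Psi p)) ->
  (forall p y, exists x, Psi p x = y) ->
  (forall p x, `|Psi p x - p| = `|x - p|) ->
  (forall p x, r0 <= `|x - p| -> Psi p x = x) ->
  exists Th : 'rV[R]_3 -> 'rV[R]_3, [/\ continuous Th, injective Th,
    forall y, exists x, Th x = y, forall x, `|Th x - x| <= 2 * r0 &
    (forall p x, p \in ps -> `|x - p| <= r0 -> Th x = Psi p x) /\
    forall x, (forall p, p \in ps -> r0 <= `|x - p|) -> Th x = x].
Proof.
move=> r00 + + Pc Pi Ps Pn Pf.
elim: ps => [_ _|p ps IH /= /andP[pnps ups] sep].
  exists id; split => // [x|y|x]; last by rewrite subrr normr0 mulr_ge0 // ltW.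
    exact: cvg_id.
  by exists y.
have [|Th [Tc Ti Ts Td [TE Tf]]] := IH ups.
  by move=> q q' qps q'ps; apply: sep; rewrite inE ?qps ?q'ps orbT.
have far q x : q \in ps -> `|x - q| <= r0 -> r0 <= `|x - p|.
  move=> qps xq; have := sep p q; rewrite !inE eqxx qps orbT => /(_ isT isT).
  have pq : p != q by apply: contraNneq pnps => ->.
  move=> /(_ pq); have := ler_distD x p q; rewrite (distrC p x); lra.
have far' x : `|x - p| <= r0 -> forall q, q \in ps -> r0 <= `|x - q|.
  move=> xp q qps; rewrite leNgt; apply/negP => xq.
  have := sep p q; rewrite !inE eqxx qps orbT => /(_ isT isT).
  have pq : p != q by apply: contraNneq pnps => ->.
  move=> /(_ pq); have := ler_distD x p q; rewrite (distrC p x); lra.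
have inP x : (exists2 q, q \in ps & `|x - q| <= r0) \/ forall q, q \in ps -> r0 <= `|x - q|.
  have [h|h] := pselect (exists2 q, q \in ps & `|x - q| <= r0); first by left.
  right=> q qps; rewrite leNgt; apply/negP => xq; apply: h; exists q => //; exact: ltW.
exists (Psi p \o Th); split.
- by move=> x; apply: continuous_comp; [exact: Tc|exact: Pc].
- by move=> x y /= /Pi /Ti.
- by move=> y; have [z <-] := Ps p y; have [x <-] := Ts z; exists x.
- move=> x /=; have [[q qps xq]|out] := inP x.
    by rewrite Pf ?Td // (TE q) //; apply: (far q) => //; rewrite Pn.
  rewrite Tf //; have [xp|xp] := leP r0 `|x - p|.
    by rewrite Pf // subrr normr0 mulr_ge0 // ltW.
  have -> : Psi p x - x = (Psi p x - p) - (x - p) by vring.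
  by apply: le_trans (ler_normB _ _) _; rewrite Pn; lra.
split.
  move=> q x; rewrite inE => /orP[/eqP -> xp|qps xq] /=.
    by rewrite Tf //; exact: far'.
  by rewrite (TE q) // Pf //; apply: (far q) => //; rewrite Pn.
move=> x out /=; rewrite Tf ?Pf //; first by apply: out; rewrite inE eqxx.
by move=> q qps; apply: out; rewrite inE qps orbT.
Qed.

Lemma coordinate_norm (R : realType) (v : 'rV[R]_3) : `|v| = 1 ->
  exists m, `|v 0 m| = 1.
Proof.
move=> v1; apply: contrapT => H.
suff : `|v| < 1 by rewrite v1 ltxx.
rewrite [ltLHS]mx_normrE; apply: bigmax_lt => //= -[i j] _ /=.
rewrite (ord1 i) lt_neqAle; apply/andP; split; last by apply: (normr_rowP v ler01).1; rewrite v1.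
by apply/eqP => E; apply: H; exists j.
Qed.

Lemma norm_coord_le (R : realType) (x : 'rV[R]_3) m : `|x 0 m| <= `|x|.
Proof. by apply: (normr_rowP x (normr_ge0 x)).1. Qed.

(** The arcs meet at endpoints only.  Each arc is looked at from both of its ends:
    the half-arc [(i, true)] is the arc [i] run backwards.  The level function
    [X i] of an arc is, up to sign, a coordinate in which its direction is
    maximal. *)
Lemma straighten_network (R : realType) (I : finType) (f : I -> R -> 'rV[R]_3)
    (v : I -> 'rV[R]_3) :
  (forall i, continuous (f i)) -> (forall i, `|v i| = 1) ->
  (forall i, nearly_straight (f i) (v i)) ->
  (forall i j s t, 0 < s < 1 -> 0 <= t <= 1 -> f i s = f j t -> i = j) ->
  exists Psi : 'rV[R]_3 -> 'rV[R]_3, [/\ continuous Psi, injective Psi,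
    forall y, exists x, Psi x = y, exists C, forall x, `|Psi x - x| <= C &
    forall i, polyline (fun t => Psi (f i t)) 0 1].
Proof.
move=> cf v1 ns disj.
pose J := (I * bool)%type.
pose g (j : J) t := f j.1 (if j.2 then 1 - t else t).
pose w (j : J) := if j.2 then - v j.1 else v j.1.
have nsg j : nearly_straight (g j) (w j).
  by case: j => i [] /=; [exact: nearly_straight_rev|exact: ns].
have cg j : continuous (g j).
  case: j => i [] /=; last exact: cf.
  move=> x; apply: (@continuous_comp _ _ _ (fun t : R => 1 - t) (f i)); last exact: cf.
  by apply: (@continuous_sub R _ R) => [|y]; [exact: cst_continuous|exact: cvg_id].
have finj i s t : 0 <= s <= 1 -> 0 <= t <= 1 -> f i s = f i t -> s = t.
  move=> /andP[s0 s1] /andP[t0 t1] E; apply/eqP; case: ltgtP => // h.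
    by have [] := ns i s t s0 h t1; rewrite E subrr normr0 ltxx.
  by have [] := ns i t s t0 h s1; rewrite E subrr normr0 ltxx.
pose p (j : J) := g j 0.
have pF i : p (i, false) = f i 0 by [].
have pT i : p (i, true) = f i 1 by rewrite /p /g /= subr0.
(* A radius [r0] such that the balls around the endpoints are disjoint and
   meet only the arcs that end at their centres. *)
have [||ra ra0 Ha] := @finite_uniform_pos R (J * J)%type
  (fun jk r => p jk.1 != p jk.2 -> 2 * r < `|p jk.1 - p jk.2|).
- by move=> jk m m' _ mm H pp; have := H pp; lra.
- move=> [j k] /=; have [->|pp] := eqVneq (p j) (p k); first by exists 1.
  have np : 0 < `|p j - p k| by rewrite normr_gt0 subr_eq0.
  by exists (`|p j - p k| / 4) => [|_]; [rewrite divr_gt0|lra].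
have [||rb rb0 Hb] := @finite_uniform_pos R (J * I)%type
  (fun ji r => p ji.1 != f ji.2 0 -> p ji.1 != f ji.2 1 ->
     forall t, 0 <= t <= 1 -> r <= `|f ji.2 t - p ji.1|).
- by move=> ji m m' _ mm H p0 p1 t t01; apply: le_trans mm _; exact: H.
- move=> [j i] /=.
  have [->|p0] := eqVneq (p j) (f i 0); first by exists 1.
  have [->|p1] := eqVneq (p j) (f i 1); first by exists 1.
  have [||m m0 Hm] := @compact_pos_bound R _ (fun t => `|f i t - p j|) _ (@segment_compact R 0 1).
  + by apply: continuous_norm; apply: continuous_sub => //; exact: cst_continuous.
  + move=> t /=; rewrite in_itv /= => /andP[t0 t1].
    rewrite normr_gt0 subr_eq0; apply/eqP => E.
    have t0' : 0 < t.
      by rewrite lt_neqAle t0 andbT; apply: contraNneq p0 => e; rewrite -E -e.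
    have t1' : t < 1.
      by rewrite lt_neqAle t1 andbT; apply: contraNneq p1 => e; rewrite -E e.
    have : exists2 s, 0 <= s <= 1 & p j = f j.1 s /\ (s = 0 \/ s = 1).
      case: (j) => k [] /=; [exists 1|exists 0] => //; rewrite ?lexx ?ler01 //.
        by rewrite pT; split; [|right].
      by rewrite pF; split; [|left].
    move=> [s s01 [ps s_or]]; rewrite ps in E.
    have ij : i = j.1 by apply: disj s01 E; rewrite t0'.
    have := finj i t s; rewrite t0 t1 s01 => /(_ isT isT); rewrite {2}ij => /(_ E).
    by case: s_or => -> e; [move: t0'|move: t1']; rewrite e ltxx.
  by exists m => // _ _ t t01; apply: Hm; rewrite /= in_itv.
pose r0 := Num.min ra (rb / 2).
have r00 : 0 < r0 by rewrite lt_min ra0 divr_gt0.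
have sep j k : p j != p k -> 2 * r0 < `|p j - p k|.
  move=> pp; have := Ha (j, k) pp => /=; have : r0 <= ra by rewrite ge_min lexx.
  lra.
have avoid j i t : p j != f i 0 -> p j != f i 1 -> 0 <= t <= 1 -> r0 < `|f i t - p j|.
  move=> p0 p1 t01; have := Hb (j, i) p0 p1 t t01 => /=.
  have : r0 <= rb / 2 by rewrite ge_min lexx orbT.
  lra.
have f01 i : f i 0 != f i 1.
  apply/eqP => /finj; rewrite !lexx ler01 => /(_ isT isT) /eqP.
  by rewrite eq_sym oner_eq0.
have f2r i : 2 * r0 < `|f i 0 - f i 1|.
  by have := sep (i, false) (i, true); rewrite pF pT => /(_ (f01 i)).
have g1 j : r0 < `|g j 1 - g j 0|.
  case: j => i []; rewrite /g /= ?subrr ?subr0.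
    by have := f2r i; lra.
  by rewrite distrC; have := f2r i; lra.
have [tau tauP] := choice (fun j => radial_param (cg j) (nsg j) r00 (g1 j)).
have gne i j s t : i != j -> g i 0 = g j 0 -> 0 < s < 1 -> 0 < t < 1 -> g i s <> g j t.
  move=> ij g0 /andP[s0 s1] /andP[t0 t1] E.
  have e : i.1 = j.1.
    apply: (@disj _ _ (if i.2 then 1 - s else s) (if j.2 then 1 - t else t)) E.
      by case: (i.2) => //; apply/andP; split; lra.
    by case: (j.2); apply/andP; split; lra.
  case: i j e ij g0 {E} => [i b] [j b'] /= <-; rewrite /g /=.
  case: b; case: b'; rewrite ?eqxx //= subr0 => _ /eqP; last by rewrite (negbTE (f01 i)).
  by rewrite eq_sym (negbTE (f01 i)).
have [Psi HPsi] := choice (untwist_vertex nsg r00 tauP gne).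
pose ps := undup [seq p j | j <- enum {: J}].
have psP q : reflect (exists j, q = p j) (q \in ps).
  rewrite mem_undup; apply: (iffP mapP) => [[j _ ->]|[j ->]]; first by exists j.
  by exists j; rewrite ?mem_enum.
have [||||||Th [Tc Ti Ts Td [TE Tf]]] := @disjoint_supports R r0 ps Psi r00 (undup_uniq _).
- move=> q q' /psP[j ->] /psP[k ->]; exact: sep.
- by move=> q; have [] := HPsi q.
- by move=> q; have [] := HPsi q.
- by move=> q y; have [_ _ h _ _] := HPsi q; exact: h.
- by move=> q y; have [_ _ _ h _] := HPsi q; exact: h.
- by move=> q y; have [_ _ _ _ [h _]] := HPsi q; exact: h.
have Tg j t : 0 <= t <= 1 -> `|g j t - g j 0| <= r0 ->
    Th (g j t) = g j 0 + (`|g j t - g j 0| / r0) *: (g j (tau j r0) - g j 0).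
  move=> t01 tr; have [_ _ _ _ [_ h]] := HPsi (g j 0).
  rewrite (TE (g j 0)) //; first exact: h.
  by apply/psP; exists j.
have tau0 j : 0 < tau j r0 < 1.
  have [/andP[t0 ->] E] := tauP j r0 (ltac:(by rewrite lexx ltW)).
  rewrite andbT lt_neqAle t0 andbT; apply: contraPneq E => <-.
  by rewrite subrr normr0 => e; move: r00; rewrite -e ltxx.
have taur j : `|g j (tau j r0) - g j 0| = r0.
  by have [_] := tauP j r0 (ltac:(by rewrite lexx ltW)).
pose lo i := tau (i, false) r0.
pose hi i := 1 - tau (i, true) r0.
have lo0 i : 0 < lo i by case/andP: (tau0 (i, false)).
have hi1 i : hi i < 1 by case/andP: (tau0 (i, true)); rewrite /hi; lra.
have hi0 i : 0 < hi i by case/andP: (tau0 (i, true)); rewrite /hi; lra.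
have lo1 i : lo i < 1 by case/andP: (tau0 (i, false)).
have flo i : `|f i (lo i) - f i 0| = r0 by have := taur (i, false).
have fhi i : `|f i (hi i) - f i 1| = r0.
  by have := taur (i, true); rewrite /g /= subr0.
have monoF i s t : 0 <= s -> s <= t -> t <= 1 -> `|f i s - f i 0| <= `|f i t - f i 0|.
  move=> s0 st t1; have := nearly_straight_mono (ns i) s0 st t1.
  by have := normr_ge0 (f i t - f i s); lra.
have monoT i s t : 0 <= s -> s <= t -> t <= 1 -> `|f i t - f i 1| <= `|f i s - f i 1|.
  move=> s0 st t1; have := nearly_straight_mono (nsg (i, true)) (s := 1 - t) (t := 1 - s).
  rewrite /g /= !subKr subr0.
  move=> /(_ ltac:(lra) ltac:(lra) ltac:(lra)).
  by have := normr_ge0 (f i s - f i t); lra.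
have lohi i : lo i < hi i.
  rewrite ltNge; apply/negP => h.
  have := monoF i (hi i) (lo i) (ltW (hi0 i)) h (ltW (lo1 i)); rewrite flo => h1.
  have := f2r i; have := ler_distD (f i (hi i)) (f i 0) (f i 1).
  by rewrite (distrC (f i 0) (f i (hi i))) fhi; lra.
(* After untwisting, the arc [i] is radial on [0, lo i] and on [hi i, 1], and
   unchanged in between. *)
have ThF i t : 0 <= t <= lo i ->
    Th (f i t) = f i 0 + (`|f i t - f i 0| / r0) *: (f i (lo i) - f i 0).
  move=> /andP[t0 tl]; apply: (Tg (i, false)); first by rewrite t0 (le_trans tl) // ltW.
  by rewrite /g /= -(flo i); apply: monoF => //; exact: ltW.
have ThT i t : hi i <= t <= 1 ->
    Th (f i t) = f i 1 + (`|f i t - f i 1| / r0) *: (f i (hi i) - f i 1).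
  move=> /andP[ht t1]; have := Tg (i, true) (1 - t).
  rewrite /g /= subKr subr0 -/(hi i); apply.
    by apply/andP; split; have := hi0 i; lra.
  by rewrite -(fhi i); apply: monoT => //; exact: ltW.
have ThM i t : lo i <= t <= hi i -> Th (f i t) = f i t.
  move=> /andP[lt th]; have t0 : 0 <= t by apply: le_trans lt; exact: ltW.
  have t1 : t <= 1 by apply: (le_trans th); exact: ltW.
  apply: Tf => _ /psP[j ->].
  have [->|p0] := eqVneq (p j) (f i 0).
    by rewrite -(flo i); apply: monoF => //; exact: ltW.
  have [->|p1] := eqVneq (p j) (f i 1).
    by rewrite -(fhi i); apply: monoT => //; exact: ltW.
  by apply: ltW; apply: avoid => //; rewrite t0.
(* The level function [X i]: along the chords of the arc, the coordinate [m i]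
   varies almost as much as the sup norm. *)
have [m Hm] := choice (fun i => coordinate_norm (v1 i)).
pose sg i : R := v i 0 (m i).
have sgn i : `|sg i| = 1 by exact: Hm.
have sg2 i : sg i * sg i = 1 by rewrite -expr2 -[LHS]ger0_norm ?sqr_ge0 // normrX sgn expr1n.
pose X i t := sg i * Th (f i t) 0 (m i).
have secant i s t : 0 <= s -> s < t -> t <= 1 ->
    15 / 16 * `|f i t - f i s| <= sg i * (f i t - f i s) 0 (m i).
  move=> s0 st t1; have [h0 h] := ns i s t s0 st t1.
  set d := f i t - f i s in h0 h *.
  have := norm_coord_le (d - `|d| *: v i) (m i); rewrite !mxE -/(sg i) => h1.
  have := ler_norm (- (sg i * (d 0 (m i) - `|d| * sg i))); rewrite normrN normrM sgn mul1r.
  have -> : sg i * (d 0 (m i) - `|d| * sg i) = sg i * d 0 (m i) - `|d| * (sg i * sg i) by ring.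
  by rewrite sg2; move: h h1; rewrite ?mxE; lra.
have cTf i : continuous (fun t => Th (f i t)).
  by move=> t; apply: continuous_comp; [exact: cf|exact: Tc].
have Xf i s t : X i t - X i s <= `|Th (f i t) - Th (f i s)|.
  have := norm_coord_le (Th (f i t) - Th (f i s)) (m i); rewrite !mxE /X -mulrBr.
  by move=> h; apply: le_trans (ler_norm _) _; rewrite normrM sgn mul1r.
have cX i : continuous (X i).
  apply: (@continuous_scale R _ R (fun=> sg i)); first exact: cst_continuous.
  move=> t; apply: (@continuous_comp _ _ _ (fun t => Th (f i t)) (fun x : 'rV[R]_3 => x 0 (m i) : R)).
    exact: cTf.
  apply: (@continuous_lipschitz R 'rV[R]_3 R _ 1) => x y; rewrite mul1r.
  by have := norm_coord_le (x - y) (m i); rewrite !mxE.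
have Th0 i : Th (f i 0) = f i 0.
  by rewrite ThF ?lexx ?ltW //= subrr normr0 mul0r scale0r addr0.
have Th1 i : Th (f i 1) = f i 1.
  by rewrite ThT ?lexx ?ltW //= subrr normr0 mul0r scale0r addr0.
have ThL i : Th (f i (lo i)) = f i (lo i) by rewrite ThM // lexx ltW.
have ThH i : Th (f i (hi i)) = f i (hi i) by rewrite ThM // lexx ltW.
have r0n : r0 != 0 by exact: lt0r_neq0.
have cdist i y : continuous (fun t => `|f i t - y| / r0).
  have -> : (fun t => `|f i t - y| / r0) = (fun t => r0^-1 *: (`|f i t - y| : R^o)).
    by apply/funext => t; rewrite mulrC.
  apply: (@continuous_scale R _ R (fun=> r0^-1)); first exact: cst_continuous.
  by apply: continuous_norm; apply: continuous_sub => //; exact: cst_continuous.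
have strF i : straight (fun t => Th (f i t)) 0 (lo i).
  apply: (@straightP _ _ (fun t => `|f i t - f i 0| / r0)) => //.
  - by rewrite subrr normr0 mul0r.
  - by rewrite flo divff.
  move=> t /andP[t0 tl]; split; last by rewrite Th0 ThL ThF ?t0.
  rewrite divr_ge0 // ?(ltW r00) //= ler_pdivrMr // mul1r -(flo i).
  by apply: monoF => //; exact: ltW.
have strT i : straight (fun t => Th (f i t)) (hi i) 1.
  apply: (@straightP _ _ (fun t => 1 - `|f i t - f i 1| / r0)) => //.
  - by apply: (@continuous_sub R _ R); [exact: cst_continuous|exact: cdist].
  - by rewrite fhi divff // subrr.
  - by rewrite subrr normr0 mul0r subr0.
  move=> t /andP[ht t1]; split; last first.
    by rewrite Th1 ThH ThT ?ht //; vring.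
  rewrite subr_ge0 ler_pdivrMr // mul1r gerBl divr_ge0 // ?(ltW r00) // andbT -(fhi i).
  by apply: monoT => //; exact: ltW.
(* The positive distance between the middle part of an arc and the other arcs. *)
have [||mm mm0 Hmm] := @finite_uniform_pos R (I * I)%type (fun ij m => ij.1 != ij.2 ->
   forall s t, lo ij.1 <= s <= hi ij.1 -> 0 <= t <= 1 ->
     m <= `|Th (f ij.1 s) - Th (f ij.2 t)|).
- by move=> ij k k' _ kk H ne s t sI tI; apply: le_trans kk _; exact: H.
- move=> [i j] /=; have [->|ij] := eqVneq i j; first by exists 1; rewrite // eqxx.
  have [||k k0 Hk] := @compact_pos_bound R _ (fun st : R * R => `|Th (f i st.1) - Th (f j st.2)|) _
     (compact_setX (@segment_compact R (lo i) (hi i)) (@segment_compact R 0 1)).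
  + apply: continuous_norm; apply: continuous_sub.
      by move=> x; apply: (@continuous_comp _ _ _ fst (fun t => Th (f i t))); [exact: cvg_fst|exact: cTf].
    by move=> x; apply: (@continuous_comp _ _ _ snd (fun t => Th (f j t))); [exact: cvg_snd|exact: cTf].
  + move=> [s t] [/=]; rewrite !in_itv /= => /andP[ls sh] t01.
    rewrite normr_gt0 subr_eq0; apply/eqP => /Ti /disj E; move/eqP: ij; apply; apply: E => //.
    by rewrite (lt_le_trans (lo0 i) ls) (le_lt_trans sh).
  by exists k => // _ s t sI tI; apply: (Hk (s, t)); split; rewrite /= in_itv.
have [||||Ps2 [c2 i2 s2 [C2 d2] p2]] :=
  @polygonalize R I (fun i t => Th (f i t)) X v lo hi mm mm0 lo0 lohi hi1 cX Xf strF strT.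
- move=> i s t ls st th.
  have s0 : 0 <= s by apply: le_trans ls; exact: ltW.
  have t1 : t <= 1 by apply: (le_trans th); exact: ltW.
  have sec := secant i s t s0 st t1; have [h0 h] := ns i s t s0 st t1.
  have sE : Th (f i s) = f i s by apply: ThM; rewrite ls (le_trans (ltW st)).
  have tE : Th (f i t) = f i t by apply: ThM; rewrite th (le_trans ls) // ltW.
  have XE : X i t - X i s = sg i * (f i t - f i s) 0 (m i).
    by rewrite /X sE tE -mulrBr !mxE.
  rewrite XE tE sE; set d := f i t - f i s in h0 h sec *; set x := sg i * _ in sec *.
  have xd : x <= `|d|.
    apply: le_trans (ler_norm _) _; rewrite normrM sgn mul1r; exact: norm_coord_le.
  split; first by lra.
  have low : 15 / 16 * `|d| <= x by [].
  have -> : d - x *: v i = (d - `|d| *: v i) + (`|d| - x) *: v i by vring.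
  apply: le_trans (ler_normD _ _) _; rewrite normrZ v1 mulr1 ger0_norm; last by lra.
  suff : `|d| - x <= 16^-1 * `|d| by lra.
  by lra.
- move=> i s t s0 st tl.
  have [sl t0] : s <= lo i /\ 0 <= t by split; [exact: le_trans tl|exact: le_trans st].
  rewrite /X (ThF i s) ?s0 ?sl // (ThF i t) ?t0 ?tl // -subr_ge0 -mulrBr.
  set e := f i (lo i) - f i 0.
  have -> : sg i * ((f i 0 + (`|f i t - f i 0| / r0) *: e) 0 (m i) -
      (f i 0 + (`|f i s - f i 0| / r0) *: e) 0 (m i)) =
     ((`|f i t - f i 0| - `|f i s - f i 0|) / r0) * (sg i * e 0 (m i)).
    by rewrite !mxE; ring.
  have := secant i 0 (lo i) (lexx 0) (lo0 i) (ltW (lo1 i)).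
  rewrite flo -/e => h; apply: mulr_ge0; last by move: r00; lra.
  apply: divr_ge0; last exact: ltW.
  rewrite subr_ge0; apply: monoF => //; exact: le_trans tl (ltW (lo1 i)).
- move=> i s t hs st t1.
  have [ht s1] : hi i <= t /\ s <= 1 by split; [exact: le_trans st|exact: le_trans t1].
  rewrite /X (ThT i s) ?hs ?s1 // (ThT i t) ?ht ?t1 // -subr_ge0 -mulrBr.
  set e := f i (hi i) - f i 1.
  have -> : sg i * ((f i 1 + (`|f i t - f i 1| / r0) *: e) 0 (m i) -
      (f i 1 + (`|f i s - f i 1| / r0) *: e) 0 (m i)) =
     ((`|f i s - f i 1| - `|f i t - f i 1|) / r0) * (sg i * (f i 1 - f i (hi i)) 0 (m i)).
    by rewrite !mxE; ring.
  have := secant i (hi i) 1 (ltW (hi0 i)) (hi1 i) (lexx 1).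
  rewrite distrC fhi => h; apply: mulr_ge0; last by move: r00; lra.
  apply: divr_ge0; last exact: ltW.
  rewrite subr_ge0; apply: monoT => //; exact: le_trans (ltW (hi0 i)) hs.
- by move=> i j s t ij sI tI; exact: (Hmm (i, j)).
exists (Ps2 \o Th); split; last exact: p2.
- by move=> x; apply: continuous_comp; [exact: Tc|exact: c2].
- by move=> x y /= /i2 /Ti.
- by move=> y; have [z <-] := s2 y; have [x <-] := Ts z; exists x.
exists (C2 + 2 * r0) => x /=.
have -> : Ps2 (Th x) - x = (Ps2 (Th x) - Th x) + (Th x - x) by vring.
by apply: le_trans (ler_normD _ _) _; apply: lerD.
Qed.

(** * Turning of polygons *)

Section Dot.
Variable R : realType.
Implicit Types u w x y z : 'rV[R]_3.

Lemma dotC u w : dot u w = dot w u.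
Proof. by apply: eq_bigr => i _; rewrite mulrC. Qed.

Lemma dotDl x y z : dot (x + y) z = dot x z + dot y z.
Proof. by rewrite -big_split; apply: eq_bigr => i _; rewrite mxE mulrDl. Qed.

Lemma dotZl k x y : dot (k *: x) y = k * dot x y.
Proof. by rewrite /dot mulr_sumr; apply: eq_bigr => i _; rewrite mxE mulrA. Qed.

Lemma dotNl x y : dot (- x) y = - dot x y.
Proof. by rewrite -scaleN1r dotZl mulN1r. Qed.

Lemma dotNr x y : dot x (- y) = - dot x y.
Proof. by rewrite dotC dotNl dotC. Qed.

Lemma dotZr k x y : dot x (k *: y) = k * dot x y.
Proof. by rewrite dotC dotZl dotC. Qed.

Lemma dotBB x y : dot (x - y) (x - y) = dot x x + dot y y - 2 * dot x y.
Proof. by rewrite dotDl dotNl dotC dotDl dotNl (dotC _ (x - y)) dotDl dotNl (dotC y x); ring. Qed.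

Lemma dot_ge0 x : 0 <= dot x x.
Proof. by apply: sumr_ge0 => i _; rewrite -expr2 sqr_ge0. Qed.

Lemma coord2_le_dot x i : `|x 0 i| ^+ 2 <= dot x x.
Proof.
rewrite /dot (bigD1 i) //= -normrX expr2 ger0_norm -?expr2 ?sqr_ge0 // lerDl.
by apply: sumr_ge0 => j _; rewrite -expr2 sqr_ge0.
Qed.

Lemma dot_le_norm x : dot x x <= 3 * `|x| ^+ 2.
Proof.
apply: le_trans (_ : \sum_(i < 3) `|x| ^+ 2 <= _).
  apply: ler_sum => i _; rewrite -expr2 -[leLHS]ger0_norm ?sqr_ge0 // normrX.
  by rewrite lerXn2r ?nnegrE // (normr_rowP x (normr_ge0 x)).1.
by rewrite sumr_const card_ord -[leLHS]mulr_natl lexx.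
Qed.

Lemma dot_eq0 x : (dot x x == 0) = (x == 0).
Proof.
apply/eqP/eqP => [d0|->]; last by rewrite /dot big1 // => i _; rewrite mxE mul0r.
apply/rowP => i; apply/eqP; rewrite mxE -normr_eq0.
by have := coord2_le_dot x i; rewrite d0 real_exprn_even_le0.
Qed.

Lemma enorm_ge0 x : 0 <= enorm x. Proof. exact: sqrtr_ge0. Qed.

Lemma enorm_eq0 x : (enorm x == 0) = (x == 0).
Proof. by rewrite /enorm sqrtr_eq0 -dot_eq0 eq_le dot_ge0 andbT. Qed.

Lemma enormZ k x : enorm (k *: x) = `|k| * enorm x.
Proof.
by rewrite /enorm dotZl dotZr mulrA -expr2 sqrtrM ?sqr_ge0 // sqrtr_sqr.
Qed.

Lemma enormN x : enorm (- x) = enorm x.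
Proof. by rewrite -scaleN1r enormZ normrN normr1 mul1r. Qed.

Lemma enorm1 x : enorm x = 1 <-> dot x x = 1.
Proof.
split=> [h|h]; last by rewrite /enorm h sqrtr1.
by rewrite -[LHS]sqr_sqrtr ?dot_ge0 // -/(enorm x) h expr1n.
Qed.

Lemma enorm_unit_dir x y : x != y -> enorm (unit_dir x y) = 1.
Proof.
move=> xy; rewrite enormZ normfV ger0_norm ?enorm_ge0 // mulVf // enorm_eq0.
by rewrite subr_eq0 eq_sym.
Qed.

Lemma unit_dirN x y : unit_dir x y = - unit_dir y x.
Proof. by rewrite /unit_dir -scalerN opprB -(opprB x y) enormN. Qed.

Lemma unit_dir_dot x y : dot (unit_dir x y) (unit_dir x y) <= 1.
Proof.
have [->|xy] := eqVneq x y; last by rewrite (enorm1 _).1 // enorm_unit_dir.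
by rewrite /unit_dir subrr scaler0 /dot big1 // => i _; rewrite mxE mul0r.
Qed.

Lemma dot_bounds u w : dot u u <= 1 -> dot w w <= 1 -> -1 <= dot u w <= 1.
Proof.
move=> u1 w1; have h1 := dot_ge0 (u - w); have h2 := dot_ge0 (u - - w).
rewrite !dotBB ?dotNr ?dotNl in h1 h2.
by apply/andP; split; lra.
Qed.

Lemma unit_dirE x y : y - x = enorm (y - x) *: unit_dir x y.
Proof.
have [->|xy] := eqVneq x y; first by rewrite /unit_dir subrr scaler0 scaler0.
by rewrite /unit_dir scalerA divff ?scale1r // enorm_eq0 subr_eq0 eq_sym.
Qed.

Definition turning x y z : R := acos (dot (unit_dir x y) (unit_dir y z)).

Lemma turning_ge0 x y z : 0 <= turning x y z.
Proof. by apply/acos_ge0/dot_bounds; exact: unit_dir_dot. Qed.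

Lemma turningE x y z : exterior_angle (unit_dir y x) (unit_dir y z) = turning x y z.
Proof. by rewrite /exterior_angle /turning dotNr (unit_dirN x y) dotNl. Qed.

(** The exterior angle is used only through this consequence: two consecutive edges
    with a small angle have close directions. *)
Lemma turning_small (eta : R) : 0 < eta -> exists2 th, 0 < th &
  forall x y z, x != y -> y != z -> turning x y z < th ->
  `|unit_dir x y - unit_dir y z| <= eta.
Proof.
move=> eta0; have e20 : 0 < eta ^+ 2 / 2 by rewrite divr_gt0 // exprn_gt0.
have [th th0 Hth] := (@continuous_epsP R R R cos).1 (@continuous_cos R) 0 _ e20.
exists th => // x y z xy yz tth.
set u := unit_dir x y; set w := unit_dir y z.
have u1 : dot u u = 1 by apply/enorm1/enorm_unit_dir.
have w1 : dot w w = 1 by apply/enorm1/enorm_unit_dir.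
have b : -1 <= dot u w <= 1 by apply: dot_bounds; rewrite ?u1 ?w1.
have := Hth (turning x y z); rewrite subr0 ger0_norm ?turning_ge0 // => /(_ tth).
rewrite /turning acosK ?in_itv //= cos0 distrC ger0_norm; last by case/andP: b; lra.
move=> h; apply/normr_rowP; first exact: ltW.
move=> i; have := coord2_le_dot (u - w) i; rewrite dotBB u1 w1 => h2.
rewrite -(@ler_pXn2r _ 2) ?nnegrE ?(ltW eta0) //.
by apply: le_trans h2 _; move: h; rewrite -/u -/w; lra.
Qed.

Lemma unit_norm_ge u : dot u u = 1 -> 2^-1 <= `|u|.
Proof.
move=> u1; have := dot_le_norm u; rewrite u1 => h.
by rewrite leNgt; apply/negP => h2; have := normr_ge0 u; nra.
Qed.

(** Unlike [unit_dir], this direction is normalized for the sup norm, in which the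
    straightening of the arcs takes place. *)
Definition sup_dir x := `|x|^-1 *: x.

Lemma sup_dirZ k x : 0 < k -> sup_dir (k *: x) = sup_dir x.
Proof.
move=> k0; rewrite /sup_dir normrZ gtr0_norm // scalerA invfM mulrAC mulVf ?mul1r //.
exact: lt0r_neq0.
Qed.

Lemma sup_dir_close x y : x != 0 -> y != 0 -> `|sup_dir x - sup_dir y| <= 2 * `|x - y| / `|x|.
Proof.
move=> x0 y0; have nx : 0 < `|x| by rewrite normr_gt0.
have ny : 0 < `|y| by rewrite normr_gt0.
have -> : sup_dir x - sup_dir y = `|x|^-1 *: (x - y) + ((`|y| - `|x|) / (`|x| * `|y|)) *: y.
  have -> : (`|y| - `|x|) / (`|x| * `|y|) = `|x|^-1 - `|y|^-1.
    by field; rewrite !lt0r_neq0.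
  by rewrite /sup_dir; vring.
apply: le_trans (ler_normD _ _) _; rewrite !normrZ.
have -> : `|(`|x|^-1)| = `|x|^-1 by rewrite ger0_norm // invr_ge0.
have -> : `|((`|x| * `|y|)^-1)| = (`|x| * `|y|)^-1 by rewrite ger0_norm // invr_ge0 mulr_ge0.
have -> : `|(`|y| - `|x|)| / (`|x| * `|y|) * `|y| = `|x|^-1 * `|(`|y| - `|x|)|.
  by field; rewrite !lt0r_neq0.
have h : `|(`|y| - `|x|)| <= `|x - y| by rewrite (distrC x); exact: ler_dist_dist.
have ix : 0 <= `|x|^-1 by rewrite invr_ge0.
by have := ler_wpM2l ix h; lra.
Qed.

(** If the polygon [A, B, C, D] turns little at [B] and at [C], then its edges, and
    hence their sum [D - A], have nearly the direction of [C - B].  The cases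
    [A = B] and [C = D] allow chords that share an end. *)
Lemma sup_dir_chord (eta : R) (A B C D : 'rV[R]_3) : 0 < eta -> eta <= 4^-1 -> B != C ->
  (A != B -> `|unit_dir A B - unit_dir B C| <= eta) ->
  (C != D -> `|unit_dir B C - unit_dir C D| <= eta) ->
  `|sup_dir (C - B) - sup_dir (D - A)| <= 4 * eta.
Proof.
move=> eta0 eta4 BC hA hC.
set u := unit_dir B C.
have u1 : dot u u = 1 by apply/enorm1/enorm_unit_dir.
have un := unit_norm_ge u1.
have u0 : u != 0 by rewrite -normr_gt0; lra.
have l2 : 0 < enorm (C - B) by rewrite lt_def enorm_ge0 enorm_eq0 subr_eq0 eq_sym BC.
pose L := enorm (B - A) + enorm (C - B) + enorm (D - C).
have L0 : 0 < L by rewrite /L; have := enorm_ge0 (B - A); have := enorm_ge0 (D - C); lra.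
pose y := L^-1 *: (D - A).
have yE : D - A = L *: y by rewrite /y scalerA divff ?scale1r // lt0r_neq0.
have hA' : `|enorm (B - A) *: (unit_dir A B - u)| <= enorm (B - A) * eta.
  have [->|AB] := eqVneq A B.
    have -> : enorm (B - B) = 0 by apply/eqP; rewrite enorm_eq0 subrr.
    by rewrite scale0r normr0 mul0r.
  by rewrite normrZ ger0_norm ?enorm_ge0 // ler_wpM2l ?enorm_ge0 // hA.
have hC' : `|enorm (D - C) *: (unit_dir C D - u)| <= enorm (D - C) * eta.
  have [->|CD] := eqVneq C D.
    have -> : enorm (D - D) = 0 by apply/eqP; rewrite enorm_eq0 subrr.
    by rewrite scale0r normr0 mul0r.
  by rewrite normrZ ger0_norm ?enorm_ge0 // ler_wpM2l ?enorm_ge0 // distrC hC.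
have uy : `|u - y| <= eta.
  rewrite -(ler_pM2l L0) -[X in X * `|_|](gtr0_norm L0) -normrZ scalerBr -yE.
  have -> : L *: u - (D - A) = - (enorm (B - A) *: (unit_dir A B - u)
      + enorm (D - C) *: (unit_dir C D - u)).
    have e1 := unit_dirE A B; have e2 := unit_dirE B C; have e3 := unit_dirE C D.
    have -> : D - A = (B - A) + (C - B) + (D - C) by vring.
    rewrite {1}e1 {1}e2 {1}e3 /L -/u; vring.
  rewrite normrN; apply: le_trans (ler_normD _ _) _.
  by have := mulr_gt0 l2 eta0; rewrite /L !mulrDl; lra.
have yn : 2^-1 <= 2 * `|y| by have := ler_distD y u 0; rewrite !subr0; lra.
have y0 : y != 0 by rewrite -normr_gt0; lra.
have -> : sup_dir (C - B) = sup_dir u by rewrite unit_dirE (sup_dirZ _ l2).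
rewrite yE (sup_dirZ y L0); apply: le_trans (sup_dir_close u0 y0) _.
rewrite ler_pdivrMr; last by lra.
by nra.
Qed.

End Dot.

(** * Arcs of finite total turning *)

Definition has_direction (R : realType) (a : R -> 'rV[R]_3) (x z : R) :=
  exists2 v, `|v| = 1 & forall s t, x <= s -> s < t -> t <= z ->
    `|a t - a s - `|a t - a s| *: v| <= 16^-1 * `|a t - a s|.

(** Any two chords are compared with the chord of the smallest interval that
    contains both, by [sup_dir_chord].  Turnings are assumed small in the open
    interval only, and the conclusion at the ends follows by continuity. *)
Lemma straight_if_no_turn (R : realType) : exists2 th : R, 0 < th &
  forall (a : R -> 'rV[R]_3) x z, continuous a -> x < z ->
  (forall s t, x < s -> s < t -> t < z -> a s != a t) ->
  (forall p q r, x < p -> p < q -> q < r -> r < z ->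
     turning (a p) (a q) (a r) < th) ->
  has_direction a x z.
Proof.
(* Two applications of [sup_dir_chord] lose a factor 8 = 128 / 16. *)
have eta0 : 0 < 128^-1 :> R by rewrite invr_gt0.
have [th th0 Hth] := turning_small eta0; exists th => // a x z ca xz ainj noturn.
have hull s t p q : x < p -> p <= s -> s < t -> t <= q -> q < z ->
    `|sup_dir (a t - a s) - sup_dir (a q - a p)| <= 4 * 128^-1.
  move=> xp ps st tq qz.
  have xs : x < s by exact: lt_le_trans ps.
  have tz : t < z by exact: le_lt_trans qz.
  apply: sup_dir_chord => //; first by lra.
  - by apply: ainj.
  - move=> ne; have p_s : p < s by rewrite lt_neqAle ps andbT; apply: contraNneq ne => ->.
    by apply: Hth => //; [exact: ainj|exact: noturn].
  - move=> ne; have t_q : t < q by rewrite lt_neqAle tq andbT; apply: contraNneq ne => ->.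
    by apply: Hth => //; [exact: ainj|exact: noturn].
pose p0 := x + (z - x) / 3; pose q0 := x + 2 * (z - x) / 3.
have [xp0 p0q0 q0z] : [/\ x < p0, p0 < q0 & q0 < z] by rewrite /p0 /q0; split; lra.
pose v := sup_dir (a q0 - a p0).
have v1 : `|v| = 1.
  have ne : 0 < `|a q0 - a p0| by rewrite normr_gt0 subr_eq0 eq_sym ainj.
  by rewrite /v /sup_dir normrZ gtr0_norm ?invr_gt0 // mulVf // lt0r_neq0.
have inner s t : x < s -> s < t -> t < z ->
    `|a t - a s - `|a t - a s| *: v| <= 16^-1 * `|a t - a s|.
  move=> xs st tz.
  have ne : 0 < `|a t - a s| by rewrite normr_gt0 subr_eq0 eq_sym ainj.
  (* [p] and [q] bound the smallest interval containing [s, t] and [p0, q0]. *)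
  pose p := Num.min s p0; pose q := Num.max t q0.
  have xp : x < p by rewrite lt_min xs.
  have qz : q < z by rewrite gt_max tz.
  have h1 := @hull s t p q xp (ltac:(by rewrite ge_min lexx)) st (ltac:(by rewrite le_max lexx)) qz.
  have h2 := @hull p0 q0 p q xp (ltac:(by rewrite ge_min lexx orbT)) p0q0
    (ltac:(by rewrite le_max lexx orbT)) qz.
  have h3 : `|sup_dir (a t - a s) - v| <= 16^-1.
    have -> : sup_dir (a t - a s) - v = (sup_dir (a t - a s) - sup_dir (a q - a p))
       - (v - sup_dir (a q - a p)) by vring.
    by apply: le_trans (ler_normB _ _) _; move: h1 h2; rewrite -/v; lra.
  have -> : a t - a s - `|a t - a s| *: v = `|a t - a s| *: (sup_dir (a t - a s) - v).
    have E : `|a t - a s| *: sup_dir (a t - a s) = a t - a s.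
      by rewrite /sup_dir scalerA divff ?scale1r // lt0r_neq0.
    by rewrite scalerBr E.
  by rewrite normrZ normr_id mulrC ler_wpM2r.
exists v => // s t xs st tz.
apply/ler_addgt0Pr => e e0.
have e8 : 0 < e / 8 by rewrite divr_gt0.
have [d1 d10 Hd1] := (continuous_epsP a).1 ca s _ e8.
have [d2 d20 Hd2] := (continuous_epsP a).1 ca t _ e8.
pose d := Num.min (Num.min d1 d2) (t - s).
have [dd1 dd2 dst] : [/\ d <= d1, d <= d2 & d <= t - s].
  by rewrite /d !ge_min !lexx !orbT.
have d0 : 0 < d by rewrite !lt_min d10 d20 subr_gt0.
pose s' := s + d / 4; pose t' := t - d / 4.
have hs : `|a s' - a s| < e / 8.
  by apply: Hd1; rewrite /s' addrAC subrr add0r gtr0_norm; lra.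
have ht : `|a t' - a t| < e / 8.
  by apply: Hd2; rewrite /t' addrAC subrr add0r normrN gtr0_norm; lra.
have := inner s' t' (ltac:(rewrite /s'; lra)) (ltac:(rewrite /s' /t'; lra)) (ltac:(rewrite /t'; lra)).
set w := a t - a s; set w' := a t' - a s' => h.
have ww : `|w - w'| <= e / 4.
  have -> : w - w' = (a s' - a s) - (a t' - a t) by rewrite /w /w'; vring.
  by apply: le_trans (ler_normB _ _) _; lra.
have -> : w - `|w| *: v = (w' - `|w'| *: v) + ((w - w') - (`|w| - `|w'|) *: v) by vring.
apply: le_trans (ler_normD _ _) _.
have h3 : `|(w - w') - (`|w| - `|w'|) *: v| <= 2 * `|w - w'|.
  apply: le_trans (ler_normB _ _) _; rewrite normrZ v1 mulr1.
  by have := ler_dist_dist w w'; lra.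
have h4 : `|w'| <= `|w| + `|w - w'|.
  by have := ler_distD w w' 0; rewrite !subr0 distrC addrC.
by lra.
Qed.

Section TotalTurning.
Variable R : realType.

Fixpoint total_turning (l : seq 'rV[R]_3) : R :=
  if l is x :: l1 then
    (if l1 is y :: z :: _ then turning x y z else 0) + total_turning l1
  else 0.

(** Concatenation only adds the turnings at the junction. *)
Lemma total_turning_cat l1 l2 :
  total_turning l1 + total_turning l2 <= total_turning (l1 ++ l2).
Proof.
elim: l1 => [|x l1 IH] /=; first by rewrite add0r.
rewrite -addrA; apply: lerD => //.
case: l1 {IH} => [|y [|z l1]] //=; last by case: l2 => // *; exact: turning_ge0.
by case: l2 => [|y [|z l2]] //; exact: turning_ge0.
Qed.

Lemma total_turning_ge0 l : 0 <= total_turning l.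
Proof.
elim: l => //= x l IH; apply: addr_ge0 => //.
by case: l {IH} => [|y [|z l]] //; exact: turning_ge0.
Qed.

Lemma total_turningE l : total_turning l =
  \sum_(1 <= k < (size l).-1) turning l`_k.-1 l`_k l`_k.+1.
Proof.
elim: l => [|x [|y [|z l]] IH]; try by rewrite big_geq //= ?addr0.
transitivity (turning x y z + total_turning [:: y, z & l]); first by [].
rewrite IH [RHS]big_ltn // big_add1; congr (_ + _).
by apply: eq_big_nat => -[|i].
Qed.

Variables (a : R -> 'rV[R]_3) (K th : R).
Hypothesis bound : forall l, l != [::] -> path <%R 0 (rcons l 1) ->
  total_turning [seq a t | t <- 0 :: rcons l 1] <= K.
Hypothesis th0 : 0 < th.

Lemma path_widen (lo hi lo' hi' : R) l : lo' <= lo -> hi <= hi' ->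
  path <%R lo (rcons l hi) -> path <%R lo' (rcons l hi').
Proof.
elim: l lo lo' => [|x l IH] lo lo' h1 h2 /=.
  by rewrite !andbT => h; apply: (le_lt_trans h1); exact: lt_le_trans h2.
by move=> /andP[lx p]; rewrite (le_lt_trans h1 lx) (IH x).
Qed.

(** Polygons with arbitrarily many turnings of size [th] inscribed in one arc would
    contradict the bound, by the Archimedean property. *)
Lemma many_turns lo hi : 0 <= lo -> hi <= 1 ->
  (forall n, exists l, path <%R lo (rcons l hi) /\
     n%:R * th <= total_turning [seq a t | t <- l]) -> False.
Proof.
move=> lo0 hi1 H.
have K0 : 0 <= K.
  have := @bound [:: 2^-1] isT; rewrite /= !andbT invr_gt0 ltr0n invf_lt1 // ltr1n => /(_ isT).
  by apply: le_trans; rewrite !addr0; exact: turning_ge0.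
have [l [pl Hl]] := H (Num.bound (K / th)).
have big : K < (Num.bound (K / th))%:R * th.
  by rewrite -ltr_pdivrMr // archi_boundP // divr_ge0 // ltW.
have pl' := path_widen lo0 hi1 pl.
have lne : l != [::].
  by apply/eqP => l0; move: Hl; rewrite l0 /= leNgt (le_lt_trans K0 big).
have := bound lne pl'; rewrite leNgt => /negP; apply.
apply: (lt_le_trans big); apply: le_trans Hl _.
rewrite /= map_rcons -cats1.
have := total_turning_cat [seq a t | t <- l] [:: a 1].
have := total_turning_cat [:: a 0] ([seq a t | t <- l] ++ [:: a 1]).
rewrite [X in X <= _]/= [X in _ <= X -> _]/=.
by rewrite /= ?addr0 ?add0r => h1 h2; apply: le_trans h2 h1.
Qed.

(** Otherwise triples with a large turning exist arbitrarily close to [x], so that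
    they can be chosen one after the other, each between [x] and the previous
    ones, and joined into polygons with an unbounded total turning. *)
Lemma no_turn_right x : 0 <= x -> x < 1 -> exists2 d, 0 < d &
  x + d <= 1 /\ forall p q r, x < p -> p < q -> q < r -> r < x + d ->
    turning (a p) (a q) (a r) < th.
Proof.
move=> x0 x1; apply: contrapT => H.
suff build n hi : x < hi -> hi <= 1 -> exists l, path <%R x (rcons l hi) /\
     n%:R * th <= total_turning [seq a t | t <- l].
  by apply: (@many_turns x 1) => // n; exact: build.
elim: n hi => [|n IH] hi xhi hi1.
  by exists [::]; rewrite /= xhi mul0r.
have [p [q [r [xp pq qr rh tpqr]]]] : exists p q r,
    [/\ x < p, p < q, q < r, r < hi & th <= turning (a p) (a q) (a r)].
  apply: contrapT => nH; apply: H; exists (hi - x); first by rewrite subr_gt0.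
  rewrite subrKC; split => // p q r xp pq qr rh; rewrite ltNge; apply/negP => tge.
  by apply: nH; exists p, q, r.
have p1 : p <= 1 by lra.
have [l [pl Hl]] := IH p xp p1.
exists (l ++ [:: p; q; r]); split.
  by rewrite rcons_cat /= -cat_rcons cat_path pl last_rcons /= pq qr rh.
rewrite map_cat; apply: le_trans (total_turning_cat _ _).
by rewrite /= !addr0 -natr1 mulrDl mul1r; apply: lerD.
Qed.

Lemma no_turn_left x : 0 < x -> x <= 1 -> exists2 d, 0 < d &
  0 <= x - d /\ forall p q r, x - d < p -> p < q -> q < r -> r < x ->
    turning (a p) (a q) (a r) < th.
Proof.
move=> x0 x1; apply: contrapT => H.
suff build n lo : 0 <= lo -> lo < x -> exists l, path <%R lo (rcons l x) /\
     n%:R * th <= total_turning [seq a t | t <- l].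
  by apply: (@many_turns 0 x) => // n; exact: build.
elim: n lo => [|n IH] lo lo0 lox.
  by exists [::]; rewrite /= lox mul0r.
have [p [q [r [lp pq qr rx tpqr]]]] : exists p q r,
    [/\ lo < p, p < q, q < r, r < x & th <= turning (a p) (a q) (a r)].
  apply: contrapT => nH; apply: H; exists (x - lo); first by rewrite subr_gt0.
  rewrite subKr; split => // p q r lp pq qr rx; rewrite ltNge; apply/negP => tge.
  by apply: nH; exists p, q, r.
have r0 : 0 <= r by lra.
have [l [pl Hl]] := IH r r0 rx.
exists ([:: p; q; r] ++ l); split; first by rewrite /= lp pq qr.
rewrite map_cat; apply: le_trans (total_turning_cat _ _).
rewrite -natr1 mulrDl mul1r addrC; apply: lerD => //=.
by rewrite !addr0.
Qed.
End TotalTurning.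

(** * The bound given by the total curvature *)

Lemma dot_continuous_row (R : realType) d (i : 'I_d) :
  continuous (fun u : 'rV[R]_(d * 3) => dot (row i (vec_mx u)) (row i (vec_mx u))).
Proof.
apply: (@continuous_sum _ _ R _ _ (fun k (u : 'rV[R]_(d * 3)) =>
   row i (vec_mx u) 0 k * row i (vec_mx u) 0 k)) => k _.
have c : continuous (fun u : 'rV[R]_(d * 3) => row i (vec_mx u) 0 k).
  have -> : (fun u : 'rV[R]_(d * 3) => row i (vec_mx u) 0 k) =
      fun u => u 0 (mxvec_index i k) by apply/funext => u; rewrite !mxE.
  exact: coord_continuous.
exact: (@continuous_scale R _ R).
Qed.

Lemma vec_mx_continuous (R : realType) m n :
  continuous (vec_mx : 'rV[R]_(m * n) -> 'M[R]_(m, n)).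
Proof.
move=> u A [P Pn PA]; have [h fK hK] := curry_mxvec_bij m n.
exists (fun _ k => P (h k).1 (h k).2).
  move=> i k; rewrite (ord1 i); have := Pn (h k).1 (h k).2; rewrite mxE.
  by have := hK k isT; case: (h k) => i' j' /= <-.
move=> w Pw; apply: PA => i j; rewrite mxE.
have fE : h (mxvec_index i j) = (i, j) by exact: (fK (i, j) isT).
by have := Pw 0 (mxvec_index i j); rewrite fE.
Qed.

(** The matrices are flattened into row vectors, among which closed bounded sets
    are compact. *)
Lemma unit_rows_compact (R : realType) d : compact (@unit_rows R d).
Proof.
have -> : @unit_rows R d = vec_mx @` [set u : 'rV[R]_(d * 3) | unit_rows (vec_mx u)].
  apply/seteqP; split => [T HT|_ [u Hu <-]] //.
  by exists (mxvec T); rewrite /= mxvecK.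
apply: continuous_compact.
  by apply: continuous_subspaceT; exact: vec_mx_continuous.
apply: bounded_closed_compact.
  exists 1; split; first exact: num_real.
  move=> M M1 u Hu; apply/normr_rowP; first by lra.
  move=> k; case/mxvec_indexP: k => i j; have := Hu i => /enorm1 h.
  have := coord2_le_dot (row i (vec_mx u)) j; rewrite h !mxE => h2.
  apply: le_trans (ltW M1).
  by rewrite -(@ler_pXn2r _ 2) ?nnegrE // expr1n.
have -> : [set u : 'rV[R]_(d * 3) | unit_rows (vec_mx u)] =
  \bigcap_(i in [set: 'I_d]) ((fun u : 'rV[R]_(d * 3) =>
     dot (row i (vec_mx u)) (row i (vec_mx u))) @^-1` [set 1]).
  apply/seteqP; split => u H i /=; first by move=> _; apply/enorm1; exact: H.
  by apply/enorm1; exact: (H i).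
apply: closed_bigI => i _; apply: closed_comp => [u _|]; first exact: dot_continuous_row.
exact: closed_eq.
Qed.

(** A continuous function on the compact set of families of [d] unit vectors. *)
Lemma contribution_bounded_below (R : realType) (c : contribution R) d : admissible c ->
  exists M, forall T, unit_rows T -> M <= c d T.
Proof.
move=> [cc _].
have [ne|/nonemptyPn E] := pselect (@unit_rows R d !=set0); last first.
  by exists 0 => T HT; have : @unit_rows R d T by []; rewrite E.
have [T0 _ H] := compact_EVT_min ne (@unit_rows_compact R d) (cc d).
by exists (c d T0) => T HT; apply: H; rewrite inE.
Qed.

Lemma path_rcons_itv (R : realType) (lo hi : R) l : path <%R lo (rcons l hi) ->
  lo < hi /\ forall t, t \in l -> lo < t < hi.
Proof.
elim: l lo => [|x l IH] lo /=; first by rewrite andbT.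
move=> /andP[lx /IH [xh H]]; split; first exact: lt_trans xh.
move=> t; rewrite inE => /orP[/eqP ->|/H /andP[xt th]]; first by rewrite lx xh.
by rewrite th (lt_trans lx xt).
Qed.

Lemma rows_col_mx (R : realType) (u w : 'rV[R]_3) :
  row 0 (col_mx u w : 'M[R]_(2, 3)) = u /\ row 1 (col_mx u w : 'M[R]_(2, 3)) = w.
Proof.
split; apply/rowP => j; rewrite !mxE.
  by case: splitP => [i _|i //]; rewrite (ord1 i).
by case: splitP => [[[|i] hi] //|i _]; rewrite (ord1 i).
Qed.

Section Graph.
Variables (R : realType) (G : fin_graph) (Gam : continuous_graph R G).

Lemma arc_neq e s t : 0 <= s -> s < t -> t <= 1 -> 0 < s \/ t < 1 ->
  edge_arc Gam e s != edge_arc Gam e t.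
Proof.
move=> s0 st t1 st01; apply/eqP => E.
have [s00|s00] := eqVneq s 0.
  have tI : t \in `]0, 1[.
    rewrite in_itv /= -{1}s00 st; case: st01 => //; by rewrite s00 ltxx.
  by apply: (@arc_neq_pos _ _ Gam e t (src e) tI); rewrite -E s00 arc_src.
have sI : s \in `]0, 1[ by rewrite in_itv /= lt_neqAle eq_sym s00 s0 (lt_le_trans st).
have [t11|t11] := eqVneq t 1.
  by apply: (@arc_neq_pos _ _ Gam e s (tgt e) sI); rewrite E t11 arc_tgt.
have tI : t \in `]0, 1[ by rewrite in_itv /= (le_lt_trans s0 st) lt_neqAle t11.
by have [_ e'] := arc_inj sI tI E; move: st; rewrite e' ltxx.
Qed.

Lemma inscribed_neq e l : l != [::] -> path <%R 0 (rcons l 1) ->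
  sorted (fun x y => x != y) [seq edge_arc Gam e t | t <- 0 :: rcons l 1].
Proof.
have pos x l' : 0 < x -> path <%R x (rcons l' 1) ->
    path (fun s t => edge_arc Gam e s != edge_arc Gam e t) x (rcons l' 1).
  elim: l' x => [|y l' IH] x x0 /=.
    by rewrite !andbT => x1; apply: arc_neq => //; [exact: ltW|left].
  move=> /andP[xy p]; rewrite IH ?(lt_trans x0 xy) // andbT.
  have [y1 _] := path_rcons_itv p.
  by apply: arc_neq => //; [exact: ltW|exact: ltW|left].
case: l => // x l _; rewrite [path _ _ _]/= => /andP[x0 p].
have [x1 _] := path_rcons_itv p.
rewrite sorted_map /=; apply/andP; split; last exact: pos.
by apply: arc_neq => //; [exact: ltW|right].
Qed.

Definition inscribed_mid e l (e' : edge G) : seq 'rV[R]_3 :=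
  [seq edge_arc Gam e' t | t <- if e' == e then l else [:: 2^-1]].

Lemma half_path : path <%R (0 : R) (rcons [:: 2^-1] 1).
Proof. by rewrite /= andbT invr_gt0 ltr0n invf_lt1 // ltr1n. Qed.

Lemma polygonal_pathE m e (s : seq R) : m e = [seq edge_arc Gam e t | t <- s] ->
  polygonal_path (pos Gam) m e = [seq edge_arc Gam e t | t <- 0 :: rcons s 1].
Proof. by rewrite /polygonal_path => ->; rewrite /= map_rcons arc_src arc_tgt. Qed.

(** The edges other than [e] get a single inner vertex, which separates the ends of
    the polygon when the edge is a loop. *)
Lemma inscribed_polygon e l : l != [::] -> path <%R 0 (rcons l 1) ->
  exists2 P : polygonal_graph R G, approximating Gam P &
    mid P e = [seq edge_arc Gam e t | t <- l].
Proof.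
move=> lne pl.
have sub e' : path <%R 0 (rcons (if e' == e then l else [:: 2^-1]) 1).
  by case: eqP => _ //; exact: half_path.
have neq e' : sorted (fun x y => x != y)
    (polygonal_path (pos Gam) (inscribed_mid e l) e').
  rewrite (polygonal_pathE (s := if e' == e then l else [:: 2^-1])) //.
  by apply: inscribed_neq; [case: ifP|exact: sub].
exists (PolygonalGraph neq); last by rewrite /= /inscribed_mid eqxx.
by split=> // e'; exists (if e' == e then l else [:: 2^-1]) => //; exact: sub.
Qed.

Lemma half_tangent_unit (P : polygonal_graph R G) h : enorm (half_tangent P h) = 1.
Proof.
have head (s : seq 'rV[R]_3) : (1 < size s)%N -> sorted (fun x y => x != y) s ->
    enorm (unit_dir s`_0 s`_1) = 1.
  by case: s => [|x [|y s]] //= _ /andP[xy _]; exact: enorm_unit_dir.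
have ss e : (1 < size (polygonal_path (ppos P) (mid P) e))%N.
  by rewrite /polygonal_path /= size_rcons.
case: h => e b; have [ssp pp] := (ss e, polygonal_path_neq P e).
rewrite /half_tangent -/(polygonal_path _ _ _); case: b; last exact: head ssp pp.
apply: (head (rev _)); first by rewrite size_rev.
rewrite rev_sorted (eq_sorted (e' := fun x y => x != y)); first exact: polygonal_path_neq.
by move=> x y; rewrite eq_sym.
Qed.

Variable c : contribution R.
Hypothesis hc : admissible c.

Lemma vertex_curvature_bounded_below : exists M, forall (P : polygonal_graph R G),
  M <= \sum_(v : vertex G) vertex_curvature c P v.
Proof.
have [M HM] := choice (fun v : vertex G => contribution_bounded_below #|star v| hc).
exists (\sum_v M v) => P; apply: ler_sum => v _; apply: HM => i.
by rewrite rowK half_tangent_unit.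
Qed.

Lemma edge_curvatureE (P : polygonal_graph R G) e :
  edge_curvature c P e = total_turning (polygonal_path (ppos P) (mid P) e).
Proof.
rewrite total_turningE /edge_curvature; set p := polygonal_path _ _ _.
have -> : (size p).-1 = (size (mid P e)).+1.
  by rewrite /p /polygonal_path /= size_rcons.
apply: eq_big_nat => k /andP[k1 k2].
have pn : forall j, (j.+1 < size p)%N -> p`_j != p`_j.+1.
  move=> j jp; have := polygonal_path_neq P e; rewrite -/p => /sortedP; exact.
have sp : size p = (size (mid P e)).+2 by rewrite /p /polygonal_path /= size_rcons.
have n1 : p`_k.-1 != p`_k.
  by have := pn k.-1; rewrite prednK // sp ltnS => /(_ (ltnW k2)).
have n2 : p`_k != p`_k.+1 by apply: pn; rewrite sp.
have [_ c2] := hc.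
set u := unit_dir _ _; set w := unit_dir _ _.
have [r0 r1] := rows_col_mx u w.
have ur : unit_rows (col_mx u w : 'M[R]_(2, 3)).
  move=> i; have [->|->] : i = 0 \/ i = 1.
    by case: i => [[|[|i]] hi] //; [left|right]; exact: val_inj.
  - by rewrite r0 enorm_unit_dir // eq_sym.
  - by rewrite r1 enorm_unit_dir.
by rewrite c2 // r0 r1 turningE.
Qed.

(** In the curvature of a polygon inscribed in the graph, all the terms but those of
    the edge [e] are bounded below. *)
Lemma turning_bound : total_curvature c Gam \is a fin_num ->
  exists K, forall e l, l != [::] -> path <%R 0 (rcons l 1) ->
    total_turning [seq edge_arc Gam e t | t <- 0 :: rcons l 1] <= K.
Proof.
move=> hfin; have [M HM] := vertex_curvature_bounded_below.
exists (fine (total_curvature c Gam) - M) => e l lne pl.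
have [P aP mP] := inscribed_polygon e lne pl.
have : ((polygonal_curvature c P)%:E <= total_curvature c Gam)%E.
  by apply: ereal_sup_ubound; exists P.
rewrite -{1}(fineK hfin) lee_fin /polygonal_curvature => h.
rewrite lerBrDl; apply: le_trans h; apply: lerD; first exact: HM.
(* The remaining edges have a nonnegative total turning. *)
rewrite (bigD1 e) //= edge_curvatureE.
have -> : polygonal_path (ppos P) (mid P) e =
    [seq edge_arc Gam e t | t <- 0 :: rcons l 1].
  rewrite /polygonal_path mP !(proj1 aP) -(polygonal_pathE (m := fun=> [seq edge_arc Gam e t | t <- l])) //.
rewrite lerDl; apply: sumr_ge0 => e' _; rewrite edge_curvatureE; exact: total_turning_ge0.
Qed.
End Graph.

(** * Tameness *)

(** The edges are continuous on [0, 1] only.  Composing them with [clamp] makes them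
    continuous on the line. *)
Definition clamp (R : realType) (t : R) : R := Num.max 0 (Num.min 1 t).

Lemma clamp_itv (R : realType) (t : R) : 0 <= clamp t <= 1.
Proof. by rewrite /clamp le_max lexx ge_max ge_min lexx ler01. Qed.

Lemma clamp_id (R : realType) (t : R) : 0 <= t <= 1 -> clamp t = t.
Proof. by move=> /andP[t0 t1]; rewrite /clamp (min_idPr t1) (max_idPr t0). Qed.

Lemma continuous_clamp (R : realType) (f : R -> 'rV[R]_3) :
  {within `[0, 1], continuous f} -> continuous (fun t => f (clamp t)).
Proof.
move=> /subspace_continuousP cf t.
have ct : {for t, continuous (@clamp R)}.
  apply: (@continuous_lipschitz R R R _ 1) => x y; rewrite mul1r.
  exact: le_trans (max_lip _ _ _) (min_lip _ _ _).
have cI (s : R) : `[0, 1]%classic (clamp s) by rewrite /= in_itv clamp_itv.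
move=> B nB.
have H : nbhs (clamp t) (fun y => `[0, 1]%classic y -> B (f y)) := cf (clamp t) (cI t) B nB.
have nt : nbhs t ((@clamp R) @^-1` (fun y => `[0, 1]%classic y -> B (f y))) := ct _ H.
change (nbhs t ((fun t => f (clamp t)) @^-1` B)).
by apply: filterS nt => s /= h; exact: h (cI s).
Qed.

Section Final.
Variables (R : realType) (G : fin_graph) (Gam : continuous_graph R G).
Let a e t := edge_arc Gam e (clamp t).

(** The first condition excludes the whole interval [0, 1], whose ends may be mapped
    to the same vertex. *)
Definition directed_piece (x z : R) : Prop :=
  (0 < x \/ z < 1) /\ forall e : edge G, has_direction (a e) x z.

Lemma directed_chain K :
  (forall e l, l != [::] -> path <%R 0 (rcons l 1) ->
    total_turning [seq edge_arc Gam e t | t <- 0 :: rcons l 1] <= K) ->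
  chain directed_piece 0 1.
Proof.
move=> bound.
have ca e : continuous (a e) by apply: continuous_clamp; exact: arc_continuous.
have aE e t : 0 <= t <= 1 -> a e t = edge_arc Gam e t by move=> t01; rewrite /a clamp_id.
have bound' e l : l != [::] -> path <%R 0 (rcons l 1) ->
    total_turning [seq a e t | t <- 0 :: rcons l 1] <= K.
  move=> lne pl; have [_ lI] := path_rcons_itv pl.
  rewrite (_ : map _ _ = [seq edge_arc Gam e t | t <- 0 :: rcons l 1]); first exact: bound.
  apply/eq_in_map => t; rewrite inE mem_rcons inE => /or3P[/eqP->|/eqP->|/lI /andP[t0 t1]];
  by apply: aE; rewrite ?lexx ?ler01 ?ltW.
have [th th0 Hth] := straight_if_no_turn R.
have inj e x z : 0 <= x -> z <= 1 -> forall s t, x < s -> s < t -> t < z -> a e s != a e t.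
  move=> x0 z1 s t xs st tz.
  have s0 : 0 < s by exact: le_lt_trans xs.
  have t1 : t < 1 by exact: lt_le_trans z1.
  rewrite !aE ?(ltW s0) ?(ltW t1) ?(ltW (lt_trans s0 st)) ?(ltW (lt_trans st t1)) //.
  by apply: arc_neq; [exact: ltW|by []|exact: ltW|left].
apply: interval_chain => //.
- by move=> x y z _ _ _ _; exact: chain_trans.
- move=> x /andP[x0 x1].
  have [||d d0 Hd] := @finite_uniform_pos R (edge G) (fun e d => x + d <= 1 /\
     forall p q r, x < p -> p < q -> q < r -> r < x + d -> turning (a e p) (a e q) (a e r) < th).
  + move=> e m m' _ mm [h H]; split; first by lra.
    by move=> p q r h1 h2 h3 h4; apply: H => //; lra.
  + move=> e; exact: (no_turn_right (bound' e) th0 x0 x1).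
  (* The second bound keeps [z] below 1, as [directed_piece] requires. *)
  exists (Num.min d ((1 - x) / 2)); first by rewrite lt_min d0 divr_gt0 ?subr_gt0.
  move=> z xz zd _.
  have dd : Num.min d ((1 - x) / 2) <= d by rewrite ge_min lexx.
  have dx : Num.min d ((1 - x) / 2) <= (1 - x) / 2 by rewrite ge_min lexx orbT.
  have z1 : z < 1 by lra.
  apply: chain_one => //; split; first by right.
  move=> e; apply: Hth => //; first by apply: inj => //; exact: ltW.
  by have [_ H] := Hd e; move=> p q r h1 h2 h3 h4; apply: H => //; lra.
- move=> x /andP[x0 x1].
  have [||d d0 Hd] := @finite_uniform_pos R (edge G) (fun e d => 0 <= x - d /\
     forall p q r, x - d < p -> p < q -> q < r -> r < x -> turning (a e p) (a e q) (a e r) < th).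
  + move=> e m m' _ mm [h H]; split; first by lra.
    by move=> p q r h1 h2 h3 h4; apply: H => //; lra.
  + move=> e; exact: (no_turn_left (bound' e) th0 x0 x1).
  (* The second bound keeps [z] above 0, as [directed_piece] requires. *)
  exists (Num.min d (x / 2)); first by rewrite lt_min d0 divr_gt0.
  move=> z zd zx _.
  have dd : Num.min d (x / 2) <= d by rewrite ge_min lexx.
  have dx : Num.min d (x / 2) <= x / 2 by rewrite ge_min lexx orbT.
  have z0 : 0 < z by lra.
  apply: chain_one => //; split; first by left.
  move=> e; apply: Hth => //; first by apply: inj => //; exact: ltW.
  by have [_ H] := Hd e; move=> p q r h1 h2 h3 h4; apply: H => //; lra.
Qed.

(** The arcs of the network are the restrictions of all the edges to the intervals
    of one common subdivision of [0, 1]. *)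
Lemma directed_chain_straightening : chain directed_piece 0 1 ->
  exists Psi : 'rV[R]_3 -> 'rV[R]_3, [/\ continuous Psi, injective Psi,
    forall y, exists x, Psi x = y, exists C, forall x, `|Psi x - x| <= C &
    forall e, polyline (fun t => Psi (edge_arc Gam e t)) 0 1].
Proof.
move=> /chain_subdivision [s ps]; set u := 0 :: rcons s 1 => Hu.
have ca e : continuous (a e) by apply: continuous_clamp; exact: arc_continuous.
have aE e t : 0 <= t <= 1 -> a e t = edge_arc Gam e t by move=> t01; rewrite /a clamp_id.
have us : sorted <%R u by [].
have su : size u = (size s).+2 by rewrite /= size_rcons.
have umono i j : (i <= j)%N -> (j < (size s).+2)%N -> u`_i <= u`_j.
  by move=> ij js; rewrite (lt_sorted_leq_nth 0 us) ?inE ?su // (leq_ltn_trans ij).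
have ustep k : (k <= size s)%N -> u`_k < u`_k.+1.
  by move=> ks; rewrite (lt_sorted_ltn_nth 0 us) ?inE ?su // ltnS leqW.
have ulast : u`_(size s).+1 = 1 by rewrite /= nth_rcons ltnn eqxx.
have u0 k : (k < (size s).+2)%N -> 0 <= u`_k by exact: (@umono 0%N).
have u1 k : (k < (size s).+2)%N -> u`_k <= 1.
  by move=> ks; rewrite -ulast; apply: umono.
pose I := (edge G * 'I_(size s).+1)%type.
pose pt (k : 'I_(size s).+1) t := u`_k + t * (u`_k.+1 - u`_k).
pose f (i : I) t := a i.1 (pt i.2 t).
have ptlt k x y : x < y -> pt k x < pt k y.
  by move=> xy; rewrite ltrD2l ltr_pM2r // subr_gt0 ustep // -ltnS.
have pt0 k : pt k 0 = u`_k by rewrite /pt mul0r addr0.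
have pt1 k : pt k 1 = u`_k.+1 by rewrite /pt mul1r subrKC.
have ptle k x y : x <= y -> pt k x <= pt k y.
  by rewrite le_eqVlt => /orP[/eqP -> //|/(ptlt k) /ltW].
have ks (k : 'I_(size s).+1) : (k < (size s).+2)%N by exact: ltnW (ltn_ord k).
have ptI k t : 0 <= t <= 1 -> 0 <= pt k t <= 1.
  move=> /andP[t0 t1]; apply/andP; split.
    by apply: (le_trans (u0 k (ks k))); rewrite -pt0 ptle.
  by apply: le_trans (u1 k.+1 (ltn_ord k)); rewrite -pt1 ptle.
have dir (i : I) : exists v : 'rV[R]_3, `|v| = 1 /\ nearly_straight (f i) v.
  case: i => e k; have [end_ /(_ e) [v v1 Hv]] := Hu k (ltn_ord k).
  exists v; split => // x y x0 xy y1.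
  have px := ptI k x (ltac:(by rewrite x0 (le_trans (ltW xy)))).
  have py := ptI k y (ltac:(by rewrite y1 (le_trans x0) // ltW)).
  split; last by apply: Hv; [rewrite -pt0 ptle|exact: ptlt|rewrite -pt1 ptle].
  rewrite normr_gt0 subr_eq0 eq_sym /f /= !aE //.
  case/andP: px => px0 _; case/andP: py => _ py1.
  apply: arc_neq => //; first exact: ptlt.
  case: end_ => [uk|uk]; [left|right].
    by apply: (lt_le_trans uk); rewrite -pt0 ptle.
  by apply: le_lt_trans uk; rewrite -pt1 ptle.
have [v Hv] := choice dir.
have cf i : continuous (f i).
  move=> t; apply: (@continuous_comp _ _ _ (pt i.2) (a i.1)); last exact: ca.
  apply: (@continuous_lipschitz R R R _ `|u`_i.2.+1 - u`_i.2|) => x y.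
  by rewrite /pt opprD addrACA subrr add0r -mulrBl normrM mulrC.
have disj i j x y : 0 < x < 1 -> 0 <= y <= 1 -> f i x = f j y -> i = j.
  case: i j => [e k] [e' l] x01 y01; have /andP[x0 x1] := x01; have /andP[y0 y1] := y01.
  have px := ptI k x (ltac:(by rewrite !ltW)); have py := ptI l y y01.
  rewrite /f /= !aE //.
  have kx : u`_k < pt k x by rewrite -pt0 ptlt.
  have xk : pt k x < u`_k.+1 by rewrite -pt1 ptlt.
  have xI : pt k x \in `]0, 1[.
    by rewrite in_itv /= (le_lt_trans (u0 k (ks k)) kx) (lt_le_trans xk (u1 k.+1 (ltn_ord k))).
  have [->|ny0] := eqVneq (pt l y) 0.
    by rewrite arc_src => /(arc_neq_pos xI).
  have [->|ny1] := eqVneq (pt l y) 1.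
    by rewrite arc_tgt => /(arc_neq_pos xI).
  have yI : pt l y \in `]0, 1[.
    by case/andP: py => h1 h2; rewrite in_itv /= !lt_neqAle eq_sym ny0 h1 ny1 h2.
  move=> /(arc_inj xI yI) [<- E].
  congr (_, _); apply: val_inj => /=.
  have ly : u`_l <= pt l y by rewrite -pt0 ptle.
  have yl : pt l y <= u`_l.+1 by rewrite -pt1 ptle.
  case: (ltngtP k l) => // h.
    by have := @umono k.+1 l h (ks l); rewrite leNgt => /negP; case; rewrite (le_lt_trans ly) // -E.
  by have := @umono l.+1 k h (ks k); rewrite leNgt => /negP; case; rewrite (lt_le_trans kx) // E.
have [Psi [Pc Pi Ps Pb Pp]] := straighten_network cf (fun i => (Hv i).1) (fun i => (Hv i).2) disj.
exists Psi; split => // e.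
apply: (@polyline_ext _ (fun t => Psi (a e t))) => [t t01|]; first by rewrite aE.
apply: (@subdivision_chain _ _ s) => u' k kss; rewrite {}/u' -/u.
have := Pp (e, Ordinal (kss : (k < (size s).+1)%N)); rewrite /f /= => p.
have := polyline_affine (f := fun t => Psi (a e t)) (ustep k kss) p.
by rewrite mul0r addr0 mul1r subrKC.
Qed.

End Final.

(** Since [polyhedral] constrains only the images of the intervals of a subdivision,
    no reparametrization is needed. *)
Lemma tame_of_polygonal_image (R : realType) (G : fin_graph)
    (Gam : continuous_graph R G) (Psi : 'rV[R]_3 -> 'rV[R]_3) (C : R) :
  continuous Psi -> injective Psi -> (forall y, exists x, Psi x = y) ->
  (forall x, `|Psi x - x| <= C) ->
  (forall e, polyline (fun t => Psi (edge_arc Gam e t)) 0 1) -> tame Gam.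
Proof.
move=> Pc Pi Ps Pb Pp.
have [g gK] := choice Ps.
have Kg : cancel Psi g by move=> x; apply: Pi; rewrite gK.
have [H isoH H1] := alexander_isotopy Pc Kg gK Pb.
pose arc e t := Psi (edge_arc Gam e t).
have arc_c e : {within `[0, 1], continuous (arc e)}.
  move=> x; apply: continuous_comp; [exact: arc_continuous|exact: Pc].
pose Gam' := @ContinuousGraph R G (fun v => Psi (pos Gam v)) arc arc_c
  (fun e => congr1 Psi (arc_src Gam e)) (fun e => congr1 Psi (arc_tgt Gam e))
  (fun v w vw => pos_inj (Pi _ _ vw))
  (fun e t v t01 E => arc_neq_pos t01 (Pi _ _ E))
  (fun e e' t t' t01 t01' E => arc_inj t01 t01' (Pi _ _ E)).
exists Gam'.
  by move=> e; have [s ps Hs] := chain_subdivision (Pp e); exists s.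
exists H => //; rewrite H1; split => // e.
by rewrite image_comp.
Qed.

Theorem corollary9 (R : realType) (c : contribution R) (G : fin_graph)
    (Gam : continuous_graph R G) (hc : admissible c) (hG : connected_graph G)
    (hfin : total_curvature c Gam \is a fin_num) :
  tame Gam.
Proof.
have [K bound] := turning_bound hc hfin.
have [Psi [Pc Pi Ps [C Pb] Pp]] := directed_chain_straightening (directed_chain bound).
exact: tame_of_polygonal_image Pc Pi Ps Pb Pp.
Qed.
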